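(* Let $I,J\subset\mathbb{R}$ be nonempty open bounded intervals with $\overline{I}\cap\overline{J}=\emptyset$. Then there exist constants $\sigma>0$ and $C>1$, depending only on the sizes of $I$ and $J$ and on the distance between $I$ and $J$, such that for every $\epsilon>0$ and every $h\in H^1(J)$ there exists a function $f\in L^2(I)$ with $$\|h-H_If\|_{L^2(J)}\le\epsilon\quad\text{and}\quad \|f\|_{L^2(I)}\le e^{C\left(1+\|h\|_{H^1(J)}^{\sigma}/\epsilon^{\sigma}\right)}\|h\|_{L^2(J)}.$$
   Context: The Hilbert transform on $L^2(\mathbb{R})$ is $Hf(x)=\mathrm{p.v.}\int_{\mathbb{R}}\frac{f(t)}{x-t}\,dt$. For an open bounded interval $I$, with characteristic function $\chi_I$, and $f\in L^2(I)$, set $H_If:=H(f\chi_I)\in L^2(\mathbb{R})$, where $f\chi_I$ denotes the extension of $f$ by zero. *)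

(* Defs.v *)
From HB Require Import structures.
From mathcomp Require Import all_boot all_order all_algebra.
From mathcomp Require Import all_classical all_reals all_analysis.

Set Implicit Arguments.
Unset Strict Implicit.
Unset Printing Implicit Defensive.

Import Order.TTheory GRing.Theory Num.Theory.
Import numFieldNormedType.Exports.

Local Open Scope classical_set_scope.
Local Open Scope ring_scope.

(* Functions on a set A are represented by functions on the whole line of which
   only the values on A matter: [f \_ A] is the extension of [f] by zero
   outside of A. All functions are real valued. *)

Definition L2 (R : realType) (A : set R) (f : R -> R) : Prop :=
  f \_ A \in Lfun (@lebesgue_measure R) 2%:E.

(* Extended-real valued, hence a finite upper bound on it is meaningful without
   knowing beforehand that [f] is in L2. *)
Definition L2norm (R : realType) (A : set R) (f : R -> R) : \bar R :=
  ('N[@lebesgue_measure R]_(2%:E) [EFin \o (f \_ A)])%E.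

Definition truncated_hilbert (R : realType) (f : R -> R) (x e : R) : R :=
  \int[@lebesgue_measure R]_(t in [set t | e < `|x - t|]) (f t / (x - t)).

(* The principal value, without the factor 1/pi; it is meaningful at the points
   x where the limit exists. *)
Definition hilbert (R : realType) (f : R -> R) (x : R) : R :=
  lim (truncated_hilbert f x e @[e --> 0^'+]).

Definition hilbert_on (R : realType) (A : set R) (f : R -> R) : R -> R :=
  hilbert (f \_ A).

Definition test_function (R : realType) (A : set R) (phi : R -> R) : Prop :=
  [/\ forall (n : nat) (x : R), derivable (derive1n n phi) x 1,
      compact (closure [set x | phi x != 0]) &
      closure [set x | phi x != 0] `<=` A].

Definition is_weak_derivative (R : realType) (A : set R) (h g : R -> R) : Prop :=
  forall phi : R -> R, test_function A phi ->
    \int[@lebesgue_measure R]_(x in A) (h x * derive1 phi x) =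
    - \int[@lebesgue_measure R]_(x in A) (g x * phi x).

Definition H1 (R : realType) (A : set R) (h : R -> R) : Prop :=
  L2 A h /\ exists g : R -> R, L2 A g /\ is_weak_derivative A h g.

(* Weak derivatives on an open set are unique up to a.e. equality, so the norm
   below does not depend on the chosen representative. *)
Definition weak_derivative (R : realType) (A : set R) (h : R -> R) : R -> R :=
  xget (cst 0) [set g | L2 A g /\ is_weak_derivative A h g].

Definition H1norm (R : realType) (A : set R) (h : R -> R) : \bar R :=
  ((L2norm A h `^ 2%R + L2norm A (weak_derivative A h) `^ 2%R) `^ (2^-1)%R)%E.

Definition set_dist (R : realType) (A B : set R) : R :=
  inf [set `|x - y| | x in A & y in B].

(* Main.v *)
Require Import Defs.
From HB Require Import structures.
From mathcomp Require Import all_boot all_order all_algebra.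
From mathcomp Require Import all_classical all_reals all_analysis.
From mathcomp Require Import measurable_realfun.
From mathcomp Require Import ring lra.

Set Implicit Arguments.
Unset Strict Implicit.
Unset Printing Implicit Defensive.

Import Order.TTheory GRing.Theory Num.Theory.
Import numFieldNormedType.Exports.

Local Open Scope classical_set_scope.
Local Open Scope ring_scope.

(** The range of the truncated Hilbert transform contains, up to small errors,
    the Cauchy kernels x |-> (x - tau)^-1 for tau in I: such a kernel is nearly
    the transform of a normalized indicator of a short interval starting at
    tau. So it suffices to approximate h on J by a linear combination of Cauchy
    kernels while keeping track of the size of the coefficients. Any loss that
    is exponential in a power of n, where n is the degree used below, is
    harmless, since sigma may be as large as one likes; here sigma = 8.

    Let m be the midpoint of I and y = kappa / (x - m), with |kappa| equal to
    the distance of I and J and the sign chosen so that y takes its values in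
    (0, 1] on J. Take a Bernstein polynomial of degree n in y of the function h
    seen in the coordinate y. It has no constant term once the node k = 0, which
    lies outside the range of y, is given the value 0. The powers y ^ j with
    1 <= j <= n are close to products of j factors kappa / (x - tau_i) with
    nodes tau_i = m + i eta, and such a product is an iterated divided
    difference of a single Cauchy kernel, so an exact linear combination of
    Cauchy kernels (lemmas [approx_pole], [polesS], [poles_near],
    [approx_bern]). With eta = exp(- O(n)) and indicators of width
    exp(- O(n ^ 2)) the errors are negligible and the control f is bounded by
    M exp(O(n ^ 2)), where M is the H1 norm of h ([cauchy_constants]).

    The Bernstein polynomial approximates because h has modulus of continuity
    1/2: at all Lebesgue points,
      |h x - h z| <= s M ^ 2 + |x - z| / (4 s)   for every s > 0.
    This is obtained from the weak derivative g without any absolutely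
    continuous representative: one tests the definition of g with a smooth
    plateau equal to 1 on most of [x, z], whose derivative is an approximate
    identity at x minus one at z ([mollify_lebesgue_pt],
    [weak_derivative_modulus]). The variance of the binomial law then gives the
    error M / (2 r) as soon as n is at least a constant times r ^ 4
    ([bernstein_good_points]). Taking r proportional to M / eps leads to
    n ^ 2 = O((M / eps) ^ 8), hence to the exponent 8.

    Finally, if the L2 norm of h is at most eps, then f = 0 works; otherwise
    M = (M / eps) eps is at most (M / eps) times the L2 norm of h, which turns
    the bound in terms of M into the required one. *)

(** * A smooth step function *)
Section smooth_step.
Context {R : realType}.
Implicit Types (f g : R -> R) (p : {poly R}) (x u : R).

(** Differentiability of the derivatives up to order n, so that test functions
    are exactly the compactly supported f with [Cn n f] for all n; the order is
    kept explicit to allow inductions. *)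
Definition Cn n f := forall k, (k <= n)%N -> forall x, derivable (derive1n k f) x 1.

Lemma CnS n f :
  Cn n.+1 f <-> (forall x, derivable f x 1) /\ Cn n (derive1 f).
Proof.
split=> [cf|[df cf] [|k] kn x].
- split; first exact: (cf 0%N).
  by move=> k kn x; rewrite -derive1Sn; exact: cf.
- exact: df.
- by rewrite derive1Sn; exact: cf.
Qed.

Lemma CnW n f : Cn n.+1 f -> Cn n f.
Proof. by move=> cf k kn; apply: cf; rewrite ltnW. Qed.

Lemma derive1_fun f (df : R -> R) :
  (forall x, is_derive x 1 f (df x)) -> derive1 f = df.
Proof. by move=> fdf; apply/funext => x; rewrite derive1E derive_val. Qed.

Lemma Cn_is_derive n f (df : R -> R) :
  (forall x, is_derive x 1 f (df x)) -> Cn n df -> Cn n.+1 f.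
Proof. by move=> fdf cdf; apply/CnS; rewrite (derive1_fun fdf); split. Qed.

Lemma Cn_derive n f : Cn n f -> forall x, is_derive x 1 f (derive1 f x).
Proof.
move=> cf x; rewrite derive1E; apply: derivableP; exact: (cf 0%N).
Qed.

Lemma CnD n f g : Cn n f -> Cn n g -> Cn n (fun x => f x + g x).
Proof.
elim: n f g => [|n ih] f g cf cg.
  move=> [|//] _ x; exact: derivableD (cf 0%N isT x) (cg 0%N isT x).
apply: (@Cn_is_derive _ _ (fun x => derive1 f x + derive1 g x)).
  move=> x; exact: is_deriveD (Cn_derive cf x) (Cn_derive cg x).
by apply: ih; [move/CnS: cf => []|move/CnS: cg => []].
Qed.

Lemma CnM n f g : Cn n f -> Cn n g -> Cn n (fun x => f x * g x).
Proof.
elim: n f g => [|n ih] f g cf cg.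
  move=> [|//] _ x; exact: derivableM (cf 0%N isT x) (cg 0%N isT x).
apply: (@Cn_is_derive _ _ (fun x => f x * derive1 g x + g x * derive1 f x)).
  move=> x; exact: is_deriveM (Cn_derive cf x) (Cn_derive cg x).
have [_ cf'] := (CnS _ _).1 cf; have [_ cg'] := (CnS _ _).1 cg.
exact: CnD (ih _ _ (CnW cf) cg') (ih _ _ (CnW cg) cf').
Qed.

Lemma Cn_cst n (c : R) : Cn n (fun=> c).
Proof.
elim: n c => [|n ih] c.
  move=> [|//] _ x; exact: derivable_cst.
exact: (@Cn_is_derive n (fun=> c) (fun=> 0)).
Qed.

Lemma CnV n f : (forall x, f x != 0) -> Cn n f -> Cn n (fun x => (f x)^-1).
Proof.
move=> f0; elim: n => [|n ih] cf.
  move=> [|//] _ x; exact: derivableV (f0 x) (cf 0%N isT x).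
apply: (@Cn_is_derive _ _ (fun x => -1 * ((f x)^-1 * (f x)^-1) * derive1 f x)).
  move=> x; apply: is_derive_eq; first exact: is_deriveV (f0 x) (Cn_derive cf x).
  by rewrite expr2 invfM mulN1r.
have cV := ih (CnW cf); have [_ cf'] := (CnS _ _).1 cf.
have := CnM (CnM (@Cn_cst n (-1)) (CnM cV cV)) cf'; apply.
Qed.

Lemma Cn_affine n f (k c : R) : Cn n f -> Cn n (fun x => f (k * x + c)).
Proof.
have aff x : is_derive x 1 (fun x => k * x + c) k.
  have := @is_deriveD _ _ _ (fun x => k * x) (cst c) x 1 (k) 0.
  rewrite addr0; apply.
  have := @is_deriveZ _ _ _ id k x 1 1.
  by rewrite /GRing.scale /= mulr1; apply.
elim: n f => [|n ih] f cf.
  move=> [|//] _ x.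
  by have [] := @is_derive1_comp _ f (fun x => k * x + c) x _ _
    (Cn_derive cf _) (aff x).
apply: (@Cn_is_derive n (fun x => f (k * x + c))
  (fun x => derive1 f (k * x + c) * k)).
  move=> x; have := @is_derive1_comp _ f (fun x => k * x + c) x _ _
    (Cn_derive cf _) (aff x).
  done.
have [_ cf'] := (CnS _ _).1 cf.
have := CnM (ih _ cf') (@Cn_cst n k); apply.
Qed.

(** The functions P(1/x) exp(-1/x), extended by 0 to x <= 0. The family is closed
    under differentiation, which gives the smoothness of exp(-1/x) at 0 by a
    plain induction on the order. *)
Definition flat p x : R := if 0 < x then p.[x^-1] * expR (- x^-1) else 0.

Lemma poly_expR_bound p k :
  exists C, forall u, 1 <= u -> `|p.[u]| * u ^+ k <= C * expR u.
Proof.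
elim/poly_ind: p k => [|p c ih] k.
  by exists 0 => u _; rewrite horner0 normr0 !mul0r.
have [C hC] := ih k.+1.
exists (C + `|c| * k`!%:R) => u u1.
have u0 : 0 <= u by rewrite (le_trans _ u1).
rewrite hornerMXaddC.
apply: (@le_trans _ _ (`|p.[u]| * u ^+ k.+1 + `|c| * u ^+ k)).
  rewrite exprS mulrA -mulrDl ler_wpM2r ?exprn_ge0//.
  by rewrite (le_trans (ler_normD _ _))// normrM (ger0_norm u0).
rewrite mulrDl lerD ?hC// -mulrA ler_wpM2l//.
case: k {ih hC} => [|k].
  rewrite expr0 fact0 mul1r (le_trans _ (expR_ge1Dx u))//.
  by rewrite lerDl.
have h := expR_ge1Dxn k u0.
rewrite mulrC -ler_pdivrMr ?ltr0n ?fact_gt0//.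
by rewrite (le_trans _ h)// lerDr.
Qed.

(** A quadratic bound at 0 is all that is needed for a zero derivative there. *)
Lemma flat_small p : exists C, forall x, `|x| <= 1 -> `|flat p x| <= C * x ^+ 2.
Proof.
have [C hC] := poly_expR_bound p 2.
exists `|C| => x x1; rewrite /flat; case: ifPn => x0; last first.
  by rewrite normr0 mulr_ge0// sqr_ge0.
have u1 : 1 <= x^-1 by rewrite invf_ge1// (le_trans (ler_norm _)).
have := hC _ u1; rewrite exprVn normrM (ger0_norm (expR_ge0 _)) expRN.
rewrite ler_pdivrMr ?exprn_gt0// => h.
rewrite ler_pdivrMr ?expR_gt0//.
rewrite (le_trans h)// mulrAC ler_wpM2r// ?expR_ge0// ler_wpM2r ?sqr_ge0//.
exact: ler_norm.
Qed.

(** The derivative of P(1/x) exp(-1/x) is (P(1/x) - P'(1/x)) x^-2 exp(-1/x). *)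
Definition dflat p : {poly R} := 'X ^+ 2 * (p - p^`()).

Lemma is_derive_flat0 p : is_derive (0 : R) 1 (flat p) 0.
Proof.
have [C hC] := flat_small p.
have f0 : flat p 0 = 0 by rewrite /flat ltxx.
have cv : h^-1 *: (flat p (h *: 1 + 0) - flat p 0) @[h --> (0 : R)^'] --> (0 : R).
  apply/cvgr0Pnorm_le => e e0.
  near=> h.
  have h0 : h != 0 by near: h; exact: nbhs_dnbhs_neq.
  have h1 : `|h| <= 1.
    by near: h; apply: dnbhs0_le.
  have h2 : `|h| <= e / (1 + `|C|).
    by near: h; apply: dnbhs0_le; rewrite divr_gt0// ltr_pwDl.
  rewrite f0 subr0 addr0 [h *: 1]mulr1 normrZ normfV.
  rewrite mulrC ler_pdivrMr ?normr_gt0// (le_trans (hC _ h1))//.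
  rewrite -real_normK ?num_real// expr2 mulrA ler_wpM2r//.
  rewrite ler_pdivlMr ?ltr_pwDl// in h2.
  apply: le_trans h2; rewrite mulrC ler_wpM2l//.
  by rewrite (le_trans (ler_norm _))// lerDr.
split.
  by apply/cvg_ex; exists 0.
by apply/cvg_lim.
Unshelve. all: by end_near. Qed.

Lemma is_derive_flat p x : is_derive x 1 (flat p) (flat (dflat p) x).
Proof.
have [x0|x0|->] := ltgtP x 0.
- rewrite {2}/flat ltNge (ltW x0) /=.
  apply: (@near_eq_is_derive _ _ _ (cst 0)); rewrite ?oner_neq0//.
  near=> y; rewrite /flat ifF//; apply/negbTE; rewrite -leNgt ltW//.
  by near: y; exact: lt_nbhsl.
- rewrite {2}/flat x0 /dflat.
  apply: (@near_eq_is_derive R R^o R^o (fun y : R => p.[y^-1] * expR (- y^-1)));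
    rewrite ?oner_neq0//.
    near=> y; rewrite /flat ifT//.
    by near: y; exact: lt_nbhsr.
  have xn0 : x != 0 by rewrite gt_eqF.
  have dV : is_derive x 1 (fun y : R => y^-1) (- x ^- 2).
    have := @is_deriveV _ id x 1 1 xn0 (is_derive_id _ _).
    by rewrite /GRing.scale /= mulr1.
  have dN : is_derive x 1 (fun y : R => - y^-1) (- - x ^- 2) by exact: is_deriveN.
  have d1 := @is_derive1_comp _ (horner p) (fun y : R => y^-1) x _ _
    (is_derive_poly _ _) dV.
  have d2 := @is_derive1_comp _ expR (fun y : R => - y^-1) x _ _
    (is_derive_expR _) dN.
  have dM : is_derive x 1 (fun y : R => p.[y^-1] * expR (- y^-1)) _ :=
    is_deriveM d1 d2.
  apply: (is_derive_eq dM).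
  rewrite hornerM hornerXn hornerD hornerN exprVn /GRing.scale /=; ring.
- rewrite {2}/flat ltxx; exact: is_derive_flat0.
Unshelve. all: by end_near. Qed.

Lemma Cn_flat n p : Cn n (flat p).
Proof.
elim: n p => [|n ih] p.
  by move=> [|//] _ x; have [] := is_derive_flat p x.
exact: (Cn_is_derive (is_derive_flat p)).
Qed.

Lemma flat1_gt0 x : 0 < x -> 0 < flat 1 x.
Proof. by move=> x0; rewrite /flat x0 hornerC mul1r expR_gt0. Qed.

Lemma flat1_ge0 x : 0 <= flat 1 x.
Proof. by have [/flat1_gt0/ltW//|x0] := ltP 0 x; rewrite /flat ltNge x0. Qed.

Lemma flat1_eq0 x : x <= 0 -> flat 1 x = 0.
Proof. by move=> x0; rewrite /flat ltNge x0. Qed.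

(** The denominator never vanishes because x and 1 - x are not both <= 0. *)
Definition step x : R := flat 1 x / (flat 1 x + flat 1 (1 - x)).

Let step_den_gt0 x : 0 < flat 1 x + flat 1 (1 - x).
Proof.
have [x0|x0] := leP x 0.
  by rewrite ltr_pwDr ?flat1_ge0// flat1_gt0// subr_gt0 (le_lt_trans x0).
by rewrite ltr_pwDl ?flat1_ge0// flat1_gt0.
Qed.

Lemma step_eq0 x : x <= 0 -> step x = 0.
Proof. by move=> x0; rewrite /step flat1_eq0// mul0r. Qed.

Lemma step_eq1 x : 1 <= x -> step x = 1.
Proof.
move=> x1; rewrite /step (@flat1_eq0 (1 - x)) ?subr_le0// addr0 divff//.
by rewrite gt_eqF// flat1_gt0// (lt_le_trans _ x1).
Qed.

Lemma step_ge0 x : 0 <= step x.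
Proof. by rewrite divr_ge0 ?flat1_ge0// ltW. Qed.

Lemma step_le1 x : step x <= 1.
Proof. by rewrite ler_pdivrMr// mul1r lerDl flat1_ge0. Qed.

Lemma Cn_step n : Cn n step.
Proof.
suff cd : Cn n (fun x => flat 1 x + flat 1 (1 - x)).
  have d0 x : flat 1 x + flat 1 (1 - x) != 0 by rewrite gt_eqF.
  have := CnM (@Cn_flat n 1) (CnV d0 cd); apply.
suff c1 : Cn n (fun x => flat 1 (1 - x)).
  have := CnD (@Cn_flat n 1) c1; apply.
have := @Cn_affine n (flat 1) (-1) 1 (@Cn_flat n 1).
by under eq_fun do rewrite mulN1r addrC.
Qed.

Lemma derive_continuous f (df : R -> R) :
  (forall x, is_derive x 1 f (df x)) -> continuous f.
Proof.
by move=> fdf x; apply/differentiable_continuous/derivable1_diffP.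
Qed.

Lemma Cn_continuous n f : Cn n f -> continuous f.
Proof. by move=> /Cn_derive; exact: derive_continuous. Qed.

Lemma Cn_continuous_derive n f : Cn n.+1 f -> continuous (derive1 f).
Proof. by move=> /CnS[_]; exact: Cn_continuous. Qed.

Lemma derive1_locally_cst f (c x : R) (A : set R) : open A -> A x ->
  (forall y, A y -> f y = c) -> derive1 f x = 0.
Proof.
move=> oA Ax fc; rewrite derive1E.
have : is_derive x 1 f (0 : R).
  apply: (@near_eq_is_derive _ _ _ (cst c)); rewrite ?oner_neq0//.
  near=> y; rewrite fc//; near: y; exact: open_nbhs_nbhs.
by move=> ?; rewrite derive_val.
Unshelve. all: by end_near. Qed.

Lemma derive1_step_eq0 x : ~~ (0 <= x <= 1) -> derive1 step x = 0.
Proof.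
rewrite negb_and -!ltNge => /orP[x0|x1].
  apply: (@derive1_locally_cst step 0 x [set y | y < 0]) => //.
  by move=> y /ltW /step_eq0.
apply: (@derive1_locally_cst step 1 x [set y | 1 < y]) => //.
by move=> y /ltW /step_eq1.
Qed.

Lemma derive1_step_bounded :
  exists2 B : R, 0 < B & forall x, `|derive1 step x| <= B.
Proof.
have cs : continuous (derive1 step) by exact: Cn_continuous_derive (@Cn_step 1).
have [z _ hz] := @EVT_max _ (fun x => `|derive1 step x|) 0 1 ler01
  (@continuous_subspaceT _ _ _ _
    (fun x => continuous_comp (cs x) (@norm_continuous _ _ _))).
exists (1 + `|derive1 step z|); first by rewrite ltr_pwDl.
move=> x; have [x01|/derive1_step_eq0->] := boolP (0 <= x <= 1).
  by rewrite (le_trans (hz x _)) ?in_itv// lerDr.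
by rewrite normr0 addr_ge0.
Qed.

End smooth_step.

(** * Square integrable and bounded functions *)
Section L2_facts.
Context {R : realType}.
Local Notation mu := (@lebesgue_measure R).
Implicit Types (A : set R) (u v : R -> R).

Definition sqint A u : R := \int[mu]_(x in A) u x ^+ 2.

Lemma sqint_ge0 A u : 0 <= sqint A u.
Proof. by apply: Rintegral_ge0 => x _; exact: sqr_ge0. Qed.

Lemma L2_measurable A u : measurable A -> L2 A u -> measurable_fun A u.
Proof.
move=> mA; rewrite /L2 inE => /andP[/[!inE]/= mu _].
exact/measurable_restrictT.
Qed.

Lemma L2_sqr_integrable A u : measurable A -> L2 A u ->
  mu.-integrable A (EFin \o (fun x => u x ^+ 2)).
Proof.
move=> mA /Lfun2_integrable_sqr iu; apply/(@integrable_mkcond _ _ _ mu A _ mA).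
congr (integrable _ _ _) : iu; apply/funext => x /=.
rewrite /patch; case: ifPn => // _.
by rewrite expr2 mulr0.
Qed.

Lemma integrable_cst A (c : R) : measurable A -> (mu A < +oo)%E ->
  mu.-integrable A (EFin \o (fun=> c)).
Proof.
move=> mA fA; apply: measurable_bounded_integrable => //.
by exists `|c|; split; [exact: num_real|move=> y cy z _ /=; exact: ltW].
Qed.

Lemma boundedW A u (B : R) : (forall x, A x -> `|u x| <= B) ->
  [bounded u x | x in A].
Proof.
move=> uB; exists B; split; first exact: num_real.
by move=> y By z Az; rewrite /= (le_trans (uB z Az))// ltW.
Qed.

Lemma integrable_bounded A u (B : R) : measurable A -> (mu A < +oo)%E ->
  measurable_fun A u -> (forall x, A x -> `|u x| <= B) ->
  mu.-integrable A (EFin \o u).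
Proof.
move=> mA fA mu_ uB; apply: measurable_bounded_integrable => //.
exact: boundedW uB.
Qed.

Lemma integrableM_bounded A u (k : R -> R) (B : R) : measurable A ->
  mu.-integrable A (EFin \o u) -> measurable_fun A k ->
  (forall x, A x -> `|k x| <= B) ->
  mu.-integrable A (EFin \o (fun x => u x * k x)).
Proof.
move=> mA iu mk kB.
have -> : EFin \o (fun x => u x * k x) =
  ((EFin \o u) \* (EFin \o k))%E by apply/funext.
by apply: integrableMl => //; exact: boundedW kB.
Qed.

Lemma integrableD_real A u v : measurable A ->
  mu.-integrable A (EFin \o u) -> mu.-integrable A (EFin \o v) ->
  mu.-integrable A (EFin \o (fun x => u x + v x)).
Proof.
move=> mA iu iv.
have -> : EFin \o (fun x => u x + v x) =
  ((EFin \o u) \+ (EFin \o v))%E by apply/funext.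
exact: integrableD.
Qed.

Lemma integrableZ_real A u (c : R) : measurable A ->
  mu.-integrable A (EFin \o u) ->
  mu.-integrable A (EFin \o (fun x => c * u x)).
Proof.
move=> mA iu.
have -> : EFin \o (fun x => c * u x) =
  (fun x => (c%:E * (EFin \o u) x)%E) by apply/funext.
exact: integrableZl.
Qed.

Lemma integrableB_real A u v : measurable A ->
  mu.-integrable A (EFin \o u) -> mu.-integrable A (EFin \o v) ->
  mu.-integrable A (EFin \o (fun x => u x - v x)).
Proof.
move=> mA iu iv; have := integrableZ_real (-1) mA iv.
move=> /(integrableD_real mA iu); congr (integrable _ _ _).
by apply/funext => x /=; rewrite mulN1r.
Qed.

(** On a set of finite measure |u| <= 1 + u^2 is integrable. *)
Lemma L2_integrable A u : measurable A -> (mu A < +oo)%E -> L2 A u ->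
  mu.-integrable A (EFin \o u).
Proof.
move=> mA fA lu.
have ig : mu.-integrable A (EFin \o (fun x => 1 + u x ^+ 2)).
  by apply: integrableD_real => //;
    [exact: integrable_cst|exact: L2_sqr_integrable].
apply: le_integrable ig => //.
  by apply/measurable_EFinP; exact: L2_measurable.
move=> x _ /=; rewrite lee_fin [leRHS]ger0_norm ?addr_ge0 ?sqr_ge0//.
rewrite -real_normK ?num_real//.
have := sqr_ge0 (`|u x| - 1); nra.
Qed.

Lemma L2normE A u :
  L2norm A u = ((\int[mu]_(x in A) (u x ^+ 2)%:E) `^ 2^-1)%E.
Proof.
rewrite /L2norm unlock; congr (_ `^ _)%E.
rewrite [RHS]integral_mkcond; apply: eq_integral => x _.
rewrite /patch /=; case: ifPn => _.
  by rewrite powR_mulrn// real_normK ?num_real.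
by rewrite normr0 powR0.
Qed.

Lemma L2norm_sqint A u : measurable A ->
  L2 A u -> L2norm A u = (Num.sqrt (sqint A u))%:E.
Proof.
move=> mA lu; rewrite L2normE -powR12_sqrt ?sqint_ge0// -poweR_EFin.
rewrite /sqint /Rintegral fineK//; apply: integrable_fin_num => //.
exact: L2_sqr_integrable.
Qed.

Lemma L2norm_bounded A u (c e l : R) : measurable A -> mu A = l%:E ->
  measurable_fun A u -> {ae mu, forall x, A x -> `|u x| <= c} ->
  0 <= c -> 0 <= e -> c ^+ 2 * l <= e ^+ 2 -> (L2norm A u <= e%:E)%E.
Proof.
move=> mA Al mu_ uc c0 e0 ce; rewrite L2normE.
have -> : (e%:E = (e ^+ 2)%:E `^ 2^-1)%E.
  by rewrite poweR_EFin powR12_sqrt ?sqr_ge0// sqrtr_sqr ger0_norm.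
apply: gt0_ler_poweR => //.
- by rewrite in_itv /= leey integral_ge0// => x _; rewrite lee_fin sqr_ge0.
- by rewrite in_itv /= leey lee_fin sqr_ge0.
apply: (@le_trans _ _ (\int[mu]_(x in A) (c ^+ 2)%:E)%E); last first.
  rewrite integral_cst// -[X in (_ * X <= _)%E]/(mu A) Al.
  by rewrite -EFinM lee_fin.
apply: ae_ge0_le_integral => //.
- by move=> x _; rewrite lee_fin sqr_ge0.
- by apply/measurable_EFinP; exact: measurable_funX.
- by move=> x _; rewrite lee_fin sqr_ge0.
case: uc => N [mN N0 sN]; exists N; split => //.
apply: subset_trans sN => x; apply: contra_not => uc Ax.
by rewrite lee_fin -(real_normK (num_real _)) ler_sqr ?nnegrE ?uc.
Qed.

Lemma L2_bounded A u (c : R) : measurable A -> (mu A < +oo)%E ->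
  measurable_fun A u -> (forall x, A x -> `|u x| <= c) -> L2 A u.
Proof.
move=> mA fA mu_ uc; rewrite /L2 inE; apply/andP; split; rewrite inE /=.
  by apply: (measurable_restrictT _ mA).1; exact: mu_.
rewrite /finite_norm.
have [l Al] : exists l, mu A = l%:E.
  by exists (fine (mu A)); rewrite fineK// ge0_fin_numE.
have l0 : 0 <= l by rewrite -lee_fin -Al.
apply: (@le_lt_trans _ _ ((Num.sqrt (`|c| ^+ 2 * l))%:E)); last exact: ltry.
apply: (@L2norm_bounded A u `|c| _ l) => //.
  apply: aeW => x Ax; rewrite (le_trans (uc _ Ax))//; exact: ler_norm.
by rewrite sqr_sqrtr// mulr_ge0// sqr_ge0.
Qed.

End L2_facts.

(** * Mollification at Lebesgue points *)
Section mollification.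
Context {R : realType}.
Local Notation mu := (@lebesgue_measure R).
Implicit Types (u : R -> R) (x r c d : R).

Definition ramp x r (z : R) : R := step (r^-1 * z + - (r^-1 * x)).

Lemma Cn_ramp n x r : Cn n (ramp x r).
Proof.
by have := @Cn_affine R n step r^-1 (- (r^-1 * x)) (@Cn_step R n); apply.
Qed.

Lemma ramp_eq0 x r z : 0 < r -> z <= x -> ramp x r z = 0.
Proof.
move=> r0 zx; apply: step_eq0.
by rewrite -mulrN -mulrDr mulr_ge0_le0 ?invr_ge0 ?(ltW r0)// subr_le0.
Qed.

Lemma ramp_eq1 x r z : 0 < r -> x + r <= z -> ramp x r z = 1.
Proof.
move=> r0 zx; apply: step_eq1.
by rewrite -mulrN -mulrDr mulrC ler_pdivlMr// mul1r lerBrDl.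
Qed.

Lemma ramp_ge0 x r z : 0 <= ramp x r z. Proof. exact: step_ge0. Qed.

Lemma ramp_le1 x r z : ramp x r z <= 1. Proof. exact: step_le1. Qed.

Lemma derive1_ramp_eq0 x r z : 0 < r -> ~~ (x <= z <= x + r) ->
  derive1 (ramp x r) z = 0.
Proof.
move=> r0; rewrite negb_and -!ltNge => /orP[zx|xz].
  apply: (@derive1_locally_cst _ _ 0 z [set y | y < x]) => //.
  by move=> y /ltW; exact: ramp_eq0.
apply: (@derive1_locally_cst _ _ 1 z [set y | x + r < y]) => //.
by move=> y /ltW; exact: ramp_eq1.
Qed.

Lemma derive1_ramp x r z :
  derive1 (ramp x r) z = r^-1 * derive1 step (r^-1 * z + - (r^-1 * x)).
Proof.
have dstep := Cn_derive (@Cn_step R 0).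
have aff : is_derive z 1 (fun z => r^-1 * z + - (r^-1 * x)) r^-1.
  have := @is_deriveD _ _ _ (fun z => r^-1 * z) (cst (- (r^-1 * x))) z 1 r^-1 0.
  rewrite addr0; apply.
  have := @is_deriveZ _ _ _ id r^-1 z 1 1.
  by rewrite /GRing.scale /= mulr1; apply.
have := @is_derive1_comp _ step (fun z => r^-1 * z + - (r^-1 * x)) z _ _
  (dstep _) aff.
by move=> ?; rewrite derive1E mulrC; apply: derive_val.
Qed.

Lemma continuous_derive1_ramp x r : continuous (derive1 (ramp x r)).
Proof. exact: Cn_continuous_derive (@Cn_ramp 1 x r). Qed.

Lemma integral_derive1_ramp x r : 0 < r ->
  \int[mu]_(z in `[x, x + r]) derive1 (ramp x r) z = 1.
Proof.
move=> r0; have xr : x < x + r by rewrite ltrDl.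
have cr := Cn_continuous (@Cn_ramp 0 x r).
rewrite /Rintegral (@continuous_FTC2 _ _ (ramp x r))//.
- by rewrite ramp_eq1// ramp_eq0// sube0.
- by apply: continuous_subspaceT; exact: continuous_derive1_ramp.
- split.
  + by move=> z _; exact: (@Cn_ramp 0 x r 0%N).
  + exact: cvg_at_right_filter (cr _).
  + exact: cvg_at_left_filter (cr _).
Qed.

(** The derivative of the ramp of width r has integral 1, is supported in
    [x, x + r] and is O(1/r), so pairing it with u - u x costs at most a constant
    times the mean of |u - u x| over the ball of radius 2 r. *)
Lemma mollify_lebesgue_pt u c d x : c < x < d ->
  mu.-integrable `]c, d[ (EFin \o u) -> lebesgue_pt (u \_ `]c, d[) x ->
  forall e : R, 0 < e -> \forall r \near 0^'+,
    `|\int[mu]_(z in `]c, d[) (u z * derive1 (ramp x r) z) - u x| <= e.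
Proof.
move=> /andP[cx xd] iu lx e e0.
(* The ball of radius 2 r has length 4 r, and the kernel is at most B / r. *)
have [B B0 hB] := @derive1_step_bounded R.
have e1 : 0 < e / (4 * B) by rewrite divr_gt0// mulr_gt0.
have davg_small : \forall r \near 0^'+,
    (davg (u \_ `]c, d[) x (2 * r) <= (e / (4 * B))%:E)%E.
  have /lx [dl /= dl0 hdl] : nbhs 0%E [set y | (y < (e / (4 * B))%:E)%E].
    by apply: open_nbhs_nbhs; split;
      [exact: open_ereal_lt_ereal|rewrite /= lte_fin].
  exists (dl / 2) => /=; first by rewrite divr_gt0.
  move=> r /=; rewrite sub0r normrN ltr_pdivlMr// mulrC => rdl r0.
  apply/ltW/hdl; last by rewrite mulr_gt0.
  by rewrite /= sub0r normrN normrM ger0_norm.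
near=> r.
have r0 : 0 < r by [].
have xrd : x + r < d.
  rewrite -ltrBrDl; near: r; apply: nbhs_right_lt; by rewrite subr_gt0.
pose J : set R := `]c, d[%classic; pose E : set R := `[x, x + r]%classic.
have EJ : E `<=` J.
  move=> z; rewrite /E /J /= !in_itv /= => /andP[xz zr].
  by rewrite (lt_le_trans cx)// (le_lt_trans zr).
have mE : measurable E by exact: measurable_itv.
have mJ : measurable J by exact: measurable_itv.
have cK := @continuous_derive1_ramp x r.
have iuE : mu.-integrable E (EFin \o u) by exact: integrableS iu.
pose k := derive1 (ramp x r).
have kB z : `|k z| <= B / r.
  rewrite /k derive1_ramp normrM gtr0_norm ?invr_gt0// mulrC.
  by rewrite ler_wpM2r ?invr_ge0 ?(ltW r0).
have JE : \int[mu]_(z in J) (u z * k z) = \int[mu]_(z in E) (u z * k z).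
  rewrite Rintegral_mkcond [RHS]Rintegral_mkcond; congr Rintegral.
  apply/funext => z; rewrite /patch.
  case: ifPn => [zJ|/negP zJ]; case: ifPn => [/set_mem zE|zE] //.
    rewrite /k derive1_ramp_eq0 ?mulr0//.
    by apply: contra zE => zE; rewrite inE /E /= in_itv.
  by exfalso; apply: zJ; rewrite inE; exact: EJ.
have mk : measurable_fun E k.
  by apply: measurable_funTS; apply: continuous_measurable_fun.
have iuk : mu.-integrable E (EFin \o (fun z => u z * k z)).
  exact: integrableM_bounded (fun z _ => kB z).
have fE : (mu E < +oo)%E.
  by rewrite /E lebesgue_measure_itv /=; case: ifP => _; rewrite ltry.
have ik : mu.-integrable E (EFin \o k).
  exact: integrable_bounded (fun z _ => kB z).
have iukx : mu.-integrable E (EFin \o (fun z => (u x * k z))).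
  exact: integrableZ_real.
rewrite -/J JE -[X in _ - X]mulr1 -(integral_derive1_ramp x r0) -/k -/E.
rewrite -RintegralZl// -RintegralB//.
have iw : mu.-integrable E (EFin \o (fun z => u z - u x)).
  by apply: integrableB_real => //; exact: integrable_cst.
have iwk : mu.-integrable E (EFin \o (fun z => (u z - u x) * k z)).
  exact: integrableM_bounded (fun z _ => kB z).
under eq_Rintegral do rewrite -mulrBl.
have iaw : mu.-integrable E (EFin \o (fun z => `|u z - u x|)).
  exact: integrable_norm.
apply: (le_trans (le_normr_Rintegral _ _)) => //.
apply: (@le_trans _ _ (\int[mu]_(z in E) (B / r * `|u z - u x|))).
  apply: le_Rintegral => //.
  - exact: integrable_norm.
  - exact: integrableZ_real.
  - by move=> z _; rewrite normrM mulrC ler_wpM2r.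
rewrite RintegralZl//.
pose W := (\int[mu]_(z in E) `|(u z - u x)%:E|)%E.
have r2 : 0 < 2 * r by rewrite mulr_gt0.
have WX : (W <= (e / (4 * B) * (4 * r))%:E)%E.
  apply: (@le_trans _ _ (\int[mu]_(z in ball x (2 * r))
      `|((u \_ J) z - (u \_ J) x)%:E|)%E).
    have -> : W = (\int[mu]_(z in E) `|((u \_ J) z - (u \_ J) x)%:E|)%E.
      apply: eq_integral => z zE; rewrite /patch !ifT//.
        by rewrite inE /J /= in_itv /= cx.
      by rewrite inE; apply: EJ; rewrite -inE.
    apply: ge0_subset_integral => //.
    - exact: measurable_ball.
    - have mb : measurable (ball x (2 * r)) by exact: measurable_ball.
      have iuJ : mu.-integrable (ball x (2 * r)) (EFin \o (u \_ J)).
        apply: (@integrableS _ _ _ _ setT) => //.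
        by rewrite -restrict_EFin; apply/(@integrable_mkcond _ _ _ mu J _ mJ).
      have fb : (mu (ball x (2 * r)) < +oo)%E.
        by rewrite lebesgue_measure_ball ?ltry// ltW.
      have := integrableB_real mb iuJ (@integrable_cst R _ ((u \_ J) x) mb fb).
      by move=> /integrable_abse /integrableP[].
    - move=> z; rewrite /E /= in_itv /= => /andP[xz zr].
      rewrite /ball /= ltr_norml; lra.
  have : (davg (u \_ J) x (2 * r) <= (e / (4 * B))%:E)%E by near: r.
  rewrite /davg /iavg (lebesgue_measure_ball _ (ltW r2)).
  rewrite inver mulrn_eq0 /= gt_eqF//.
  rewrite lee_pdivrMl ?mulrn_wgt0// -EFinM.
  set X := (X in (_ <= X)%E -> _); set Y := (Y in _ -> (_ <= Y)%E).
  suff -> : X = Y by [].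
  by rewrite /X /Y; congr EFin; ring.
have fW : W \is a fin_num.
  by rewrite ge0_fin_numE ?integral_ge0// (le_lt_trans WX)// ltry.
rewrite /Rintegral -/W.
move: WX; rewrite -(fineK fW) lee_fin => WX.
apply: (@le_trans _ _ (B / r * (e / (4 * B) * (4 * r)))).
  by rewrite ler_wpM2l// divr_ge0// ltW.
rewrite le_eqVlt; apply/orP; left; apply/eqP; field.
by rewrite !gt_eqF.
Unshelve. all: by end_near. Qed.

End mollification.

(** * Modulus of continuity from the weak derivative *)
Section weak_derivative_modulus.
Context {R : realType}.
Local Notation mu := (@lebesgue_measure R).
Implicit Types (h g : R -> R) (x y r s c d : R).

Definition plateau x y r (z : R) : R := ramp x r z - ramp y r z.

Lemma plateau_eq0 x y r z : 0 < r -> x <= y -> ~~ (x <= z <= y + r) ->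
  plateau x y r z = 0.
Proof.
move=> r0 xy; rewrite negb_and -!ltNge /plateau => /orP[/ltW zx|/ltW zy].
  by rewrite !ramp_eq0 ?subrr// (le_trans zx).
by rewrite !ramp_eq1 ?subrr// (le_trans _ zy)// lerD2r.
Qed.

Lemma normr_plateau_le1 x y r z : `|plateau x y r z| <= 1.
Proof.
have := ramp_ge0 x r z; have := ramp_ge0 y r z.
have := ramp_le1 x r z; have := ramp_le1 y r z.
rewrite /plateau ler_norml; lra.
Qed.

Lemma Cn_plateau n x y r : Cn n (plateau x y r).
Proof.
have := CnD (@Cn_ramp R n x r) (CnM (@Cn_cst R n (-1)) (@Cn_ramp R n y r)).
by under eq_fun do rewrite mulN1r.
Qed.

Lemma derive1_plateau x y r z :
  derive1 (plateau x y r) z = derive1 (ramp x r) z - derive1 (ramp y r) z.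
Proof.
rewrite derive1E.
have dx := Cn_derive (@Cn_ramp R 0 x r) z.
have dy := Cn_derive (@Cn_ramp R 0 y r) z.
have dxy : is_derive z 1 (plateau x y r) _ := is_deriveB dx dy.
exact: derive_val.
Qed.

Lemma test_function_plateau c d x y r : 0 < r -> c < x -> x <= y -> y + r < d ->
  test_function `]c, d[ (plateau x y r).
Proof.
move=> r0 cx xy yd.
have sE : closure [set z | plateau x y r z != 0] `<=` `[x, y + r].
  have cE : closed (`[x, y + r]%classic : set R) by exact: itv_closed.
  rewrite [X in _ `<=` X]((closure_id _).1 cE).
  apply: closure_subset => z /= ; rewrite in_itv /=.
  by apply: contra_neqT; exact: plateau_eq0.
split.
- by move=> n z; exact: (@Cn_plateau n x y r n).
- apply: subclosed_compact sE; last exact: segment_compact.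
  exact: closed_closure.
- apply: (subset_trans sE) => z /=; rewrite !in_itv /= => /andP[xz zy].
  by rewrite (lt_le_trans cx)// (le_lt_trans zy).
Qed.

(** Testing with the plateau gives h x - h y up to o(1) on one side and, up to
    sign, the integral of g times the plateau on the other; the latter is at
    most s g^2 + 1 / (4 s) integrated over [x, y + r], by the inequality
    |g| <= s g^2 + 1 / (4 s). Optimizing s would give the usual Hoelder bound of
    exponent 1/2, but keeping s free avoids square roots. *)
Lemma weak_derivative_modulus h g c d x y s :
  mu.-integrable `]c, d[ (EFin \o h) -> L2 `]c, d[ g ->
  is_weak_derivative `]c, d[ h g ->
  lebesgue_pt (h \_ `]c, d[) x -> lebesgue_pt (h \_ `]c, d[) y ->
  c < x -> x < y -> y < d -> 0 < s ->
  `|h x - h y| <= s * sqint `]c, d[ g + (y - x) / (4 * s).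
Proof.
move=> ih lg hg lx ly cx xy yd s0.
pose J : set R := `]c, d[%classic.
have mJ : measurable J by exact: measurable_itv.
have xJ : c < x < d by rewrite cx (lt_trans xy).
have yJ : c < y < d by rewrite yd (lt_trans cx).
suff main : forall e, 0 < e ->
    `|h x - h y| <= s * sqint J g + (y - x + e) / (4 * s) + (e + e).
  apply/ler_addgt0Pr => e e0.
  pose e' := e / (2 + (4 * s)^-1).
  have c0 : 0 < 2 + (4 * s)^-1 by rewrite addr_gt0// invr_gt0 mulr_gt0.
  have e'0 : 0 < e' by rewrite divr_gt0.
  rewrite (le_trans (main _ e'0))// mulrDl -!addrA !lerD2l.
  have -> : e' / (4 * s) + (e' + e') = e' * (2 + (4 * s)^-1) by ring.
  by rewrite divfK// gt_eqF.
move=> e e0.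
near (0 : R)^'+ => r.
have r0 : 0 < r by [].
have re : r <= e by near: r; exact: nbhs_right_le.
have yrd : y + r < d.
  by rewrite -ltrBrDl; near: r; apply: nbhs_right_lt; rewrite subr_gt0.
have Ax : `|\int[mu]_(z in J) (h z * derive1 (ramp x r) z) - h x| <= e.
  by near: r; exact: mollify_lebesgue_pt.
have Ay : `|\int[mu]_(z in J) (h z * derive1 (ramp y r) z) - h y| <= e.
  by near: r; exact: mollify_lebesgue_pt.
have ihr w : mu.-integrable J (EFin \o (fun z => h z * derive1 (ramp w r) z)).
  have [B B0 hB] := @derive1_step_bounded R.
  apply: (@integrableM_bounded _ _ _ _ (r^-1 * B)) => //.
    apply: measurable_funTS; apply: continuous_measurable_fun.
    exact: continuous_derive1_ramp.
  move=> z _; rewrite derive1_ramp normrM gtr0_norm ?invr_gt0//.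
  by rewrite ler_wpM2l ?invr_ge0 ?(ltW r0).
have := hg _ (test_function_plateau r0 cx (ltW xy) yrd).
under eq_Rintegral do rewrite derive1_plateau mulrBr.
rewrite RintegralB// -/J; set X := (\int[mu]_(z in J) (h z * _)).
set Y := (\int[mu]_(z in J) (h z * _)); set G := (\int[mu]_(z in J) (g z * _)).
move=> XYG.
suff Gle : `|G| <= s * sqint J g + (y - x + e) / (4 * s).
  have -> : h x - h y = (- (X - h x) - G) + (Y - h y) by rewrite -XYG; ring.
  apply: (le_trans (ler_normD _ _)).
  have := ler_normB (- (X - h x)) G; rewrite normrN.
  move: Ax Ay; rewrite -/X -/Y; lra.
pose E : set R := `[x, y + r]%classic.
have mE : measurable E by exact: measurable_itv.
have EJ : E `<=` J.
  move=> z; rewrite /E /J /= !in_itv /= => /andP[xz zy].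
  by rewrite (lt_le_trans cx)// (le_lt_trans zy).
have fJ : (mu J < +oo)%E.
  by rewrite /J lebesgue_measure_itv /=; case: ifP => _; rewrite ltry.
have ig : mu.-integrable J (EFin \o g) by exact: L2_integrable.
have ig2 := L2_sqr_integrable mJ lg.
have mp : measurable_fun J (plateau x y r).
  apply: measurable_funTS; apply: continuous_measurable_fun.
  exact: Cn_continuous (@Cn_plateau 0 x y r).
have igp : mu.-integrable J (EFin \o (fun z => g z * plateau x y r z)).
  exact: integrableM_bounded (fun z _ => normr_plateau_le1 x y r z).
have i1 : mu.-integrable J (EFin \o (\1_E : R -> R)).
  apply: (@integrable_bounded _ _ _ 1) => //.
  by move=> z _; rewrite indicE; case: (_ \in _); rewrite ?normr1 ?normr0.
have i1s : mu.-integrable J (EFin \o (fun z => (4 * s)^-1 * (\1_E z : R))).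
  exact: integrableZ_real.
have igs : mu.-integrable J (EFin \o (fun z => s * g z ^+ 2)).
  exact: integrableZ_real.
apply: (le_trans (le_normr_Rintegral _ _)) => //.
apply: (@le_trans _ _ (\int[mu]_(z in J) (s * g z ^+ 2 + (4 * s)^-1 * \1_E z))).
  apply: le_Rintegral => //.
  - exact: integrable_norm.
  - exact: integrableD_real.
  - move=> z _; rewrite normrM indicE.
    have [zE|zE] := boolP (z \in E); last first.
      rewrite plateau_eq0 ?normr0 ?mulr0 ?addr0 ?(ltW xy)//.
        by rewrite mulr_ge0 ?sqr_ge0 ?ltW.
      by apply: contra zE => zE; rewrite inE /E /= in_itv.
    rewrite mulr1; apply: (@le_trans _ _ `|g z|).
      by rewrite ler_piMr// normr_plateau_le1.
    rewrite -subr_ge0.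
    have -> : s * g z ^+ 2 + (4 * s)^-1 - `|g z| =
        (4 * s)^-1 * (2 * s * `|g z| - 1) ^+ 2.
      rewrite -(real_normK (num_real (g z))); field.
      by rewrite gt_eqF.
    by rewrite mulr_ge0 ?sqr_ge0// invr_ge0 mulr_ge0// ltW.
rewrite RintegralD// RintegralZl// RintegralZl// lerD2l mulrC.
rewrite ler_wpM2r// ?invr_ge0 ?mulr_ge0 ?(ltW s0)//.
have -> : \int[mu]_(z in J) (\1_E z : R) = y + r - x.
  have muE : mu E = (y + r - x)%:E.
    by rewrite /E lebesgue_measure_itv /= lte_fin ifT//; lra.
  by rewrite /Rintegral integral_indic// setIidl// -[X in fine X]/(mu E) muE.
by lra.
Unshelve. all: by end_near. Qed.

End weak_derivative_modulus.

(** * Pointwise control of H1 functions *)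
Section good_points.
Context {R : realType}.
Local Notation mu := (@lebesgue_measure R).
Implicit Types (h g : R -> R) (c d : R) (D : set R).

Lemma ae_itv_meets c d D p q : {ae mu, forall x, `]c, d[%classic x -> D x} ->
  c <= p -> p < q -> q <= d -> exists2 z, D z & p < z < q.
Proof.
move=> [N [mN N0 sN]] cp pq qd; apply: contrapT => noz.
have sub : `]p, q[%classic `<=` N.
  move=> z /=; rewrite in_itv /= => pzq; apply: sN => /= zD.
  apply: noz; exists z => //; apply: zD; rewrite in_itv /=.
  by case/andP: pzq => pz zq; rewrite (le_lt_trans cp)// (lt_le_trans zq).
have : (mu `]p, q[%classic <= mu N)%E.
  by apply: le_measure => //; rewrite inE.
rewrite [X in (_ <= X)%E]N0 lebesgue_measure_itv /= lte_fin pq.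
by rewrite -EFinB lee_fin leNgt subr_gt0 pq.
Qed.

Lemma H1normE c d h : H1 `]c, d[ h ->
  H1norm `]c, d[ h = (Num.sqrt (sqint `]c, d[ h +
    sqint `]c, d[ (weak_derivative `]c, d[ h)))%:E.
Proof.
move=> [lh wh]; rewrite /H1norm.
have [lg _] := xgetPex (cst 0) wh.
rewrite !L2norm_sqint//.
rewrite !poweR_EFin !powR_mulrn ?sqrtr_ge0// !sqr_sqrtr ?sqint_ge0//.
by rewrite powR12_sqrt// addr_ge0 ?sqint_ge0.
Qed.

(** Otherwise h^2 would exceed 2 M^2 / (d - c) almost everywhere and its integral
    would be at least 2 M^2; the factor 2 makes the contradiction strict. *)
Lemma L2_small_value c d h D (M : R) : c < d -> L2 `]c, d[ h -> 0 < M ->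
  sqint `]c, d[ h <= M ^+ 2 ->
  {ae mu, forall x, `]c, d[%classic x -> D x} ->
  exists2 z, D z & h z ^+ 2 <= 2 * M ^+ 2 / (d - c).
Proof.
move=> cd lh M0 hM aeD; apply: contrapT => noz.
have dc0 : 0 < d - c by rewrite subr_gt0.
have mJ : measurable (`]c, d[%classic : set R) by exact: measurable_itv.
have ih2 := L2_sqr_integrable mJ lh.
have muJ : mu `]c, d[%classic = (d - c)%:E.
  by rewrite lebesgue_measure_itv /= lte_fin cd.
have : (\int[mu]_(x in `]c, d[) (2 * M ^+ 2 / (d - c))%:E <=
        \int[mu]_(x in `]c, d[) (h x ^+ 2)%:E)%E.
  apply: ae_ge0_le_integral => //.
  - by move=> x _; rewrite lee_fin divr_ge0 ?(ltW dc0)// mulr_ge0 ?sqr_ge0.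
  - by move=> x _; rewrite lee_fin sqr_ge0.
  - by case/integrableP: ih2.
  case: aeD => N [mN N0 sN]; exists N; split => //.
  apply: subset_trans sN => x; apply: contra_not => xD xJ.
  rewrite lee_fin leNgt; apply/negP => hx.
  by apply: noz; exists x; [exact: xD|exact: ltW].
rewrite integral_cst// -[X in (_ * X <= _)%E]/(mu `]c, d[%classic) muJ.
rewrite -EFinM divfK ?gt_eqF//.
have -> : (\int[mu]_(x in `]c, d[) (h x ^+ 2)%:E = (sqint `]c, d[ h)%:E)%E.
  by rewrite /sqint /Rintegral fineK//; exact: integrable_fin_num.
have := exprn_gt0 2 M0; rewrite lee_fin; lra.
Qed.

(** The good points are the Lebesgue points of h. The sup bound starts from a
    point where h^2 is at most 2 M^2 / (d - c) and spreads from there by the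
    modulus of continuity with s = 1 / M. *)
Lemma H1_good_points c d h : c < d -> H1 `]c, d[ h ->
  0 < fine (H1norm `]c, d[ h) ->
  let M := fine (H1norm `]c, d[ h) in
  exists D, [/\ D `<=` `]c, d[%classic,
    {ae mu, forall x, `]c, d[%classic x -> D x},
    forall x z s, D x -> D z -> 0 < s ->
      `|h x - h z| <= s * M ^+ 2 + `|x - z| / (4 * s) &
    forall z, D z -> `|h z| <= (2 + 2 / (d - c) + (d - c) / 4) * M].
Proof.
move=> cd Hh M0 M.
have mJ : measurable (`]c, d[%classic : set R) by exact: measurable_itv.
have dc0 : 0 < d - c by rewrite subr_gt0.
have fJ : (mu `]c, d[%classic < +oo)%E.
  by rewrite lebesgue_measure_itv /=; case: ifP => _; rewrite ltry.
have [lh wh] := Hh.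
have [lg hg] := xgetPex (cst 0) wh.
set g := xget _ _ in lg hg.
have M2 : M ^+ 2 = sqint `]c, d[ h + sqint `]c, d[ g.
  by rewrite /M H1normE//= sqr_sqrtr// addr_ge0 ?sqint_ge0.
have hM : sqint `]c, d[ h <= M ^+ 2 by rewrite M2 lerDl sqint_ge0.
have gM : sqint `]c, d[ g <= M ^+ 2 by rewrite M2 lerDr sqint_ge0.
have ih : mu.-integrable `]c, d[ (EFin \o h) by exact: L2_integrable.
pose D := [set x : R | x \in `]c, d[%R /\ lebesgue_pt (h \_ `]c, d[) x].
have aeD : {ae mu, forall x, `]c, d[%classic x -> D x}.
  have lih : locally_integrable setT (h \_ `]c, d[) by exact: integrable_locally.
  have [N [mN N0 sN]] := lebesgue_differentiation lih.
  exists N; split => //.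
  by apply: subset_trans sN => x; apply: contra_not => xl xJ; split.
have modlt x z s : D x -> D z -> 0 < s -> x < z ->
    `|h x - h z| <= s * M ^+ 2 + `|x - z| / (4 * s).
  move=> [xJ lx] [zJ lz] s0 xz.
  move: xJ zJ; rewrite !in_itv /= => /andP[cx _] /andP[_ zd].
  apply: (le_trans (weak_derivative_modulus ih lg hg lx lz cx xz zd s0)).
  rewrite distrC gtr0_norm ?subr_gt0// lerD2r.
  by rewrite ler_wpM2l// ltW.
have mod x z s : D x -> D z -> 0 < s ->
    `|h x - h z| <= s * M ^+ 2 + `|x - z| / (4 * s).
  move=> Dx Dz s0; have [xz|zx|->] := ltgtP x z.
  - exact: modlt.
  - by rewrite distrC (distrC x); exact: modlt.
  - rewrite !subrr !normr0 mul0r addr0 mulr_ge0 ?sqr_ge0//; exact: ltW.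
exists D; split => //.
  by move=> x [].
move=> z Dz.
have [z0 Dz0 hz0] := L2_small_value cd lh M0 hM aeD.
have hz0' : `|h z0| <= (1 + 2 / (d - c)) * M.
  have t0 : 0 < 2 / (d - c) by rewrite divr_gt0.
  rewrite -ler_sqr ?nnegrE ?mulr_ge0 ?addr_ge0 ?(ltW t0) ?(ltW M0)//.
  rewrite real_normK ?num_real// (le_trans hz0)// exprMn.
  rewrite mulrAC ler_wpM2r ?sqr_ge0//.
  set t := (2 / (d - c)) in t0 *; nra.
have := mod z z0 M^-1 Dz Dz0; rewrite invr_gt0 => /(_ M0).
have -> : M^-1 * M ^+ 2 = M by rewrite expr2 mulKf// gt_eqF.
rewrite invfM invrK => hzz0.
have zz0 : `|z - z0| <= d - c.
  case: Dz Dz0 => + _ [+ _]; rewrite !in_itv /= => /andP[? ?] /andP[? ?].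
  rewrite ler_norml; lra.
have : `|z - z0| * (4^-1 * M) <= (d - c) * (4^-1 * M).
  by rewrite ler_wpM2r// mulr_ge0// ltW.
have := ler_normD (h z - h z0) (h z0); rewrite subrK.
lra.
Qed.

End good_points.

(** * Bernstein polynomials *)
Section bernstein.
Context {R : realFieldType}.
Implicit Types (n k : nat) (v : nat -> R) (y : R).

(** The Bernstein polynomial sum_k C(n, k) v_k y^k (1 - y)^(n - k), that is the
    mean of v_K for K binomial of parameters n and y, computed by conditioning
    on the first trial. This form yields the variance without binomial
    identities, and mirrors how the polynomial is approximated later. *)
Fixpoint bern n v y : R :=
  if n is n'.+1 then y * bern n' (v \o S) y + (1 - y) * bern n' v y else v 0%N.

Lemma bern_affine n v (a b y : R) :
  bern n (fun k => a + b * v k) y = a + b * bern n v y.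
Proof.
elim: n v => [//|n ih] v /=.
rewrite (ih v) -[X in y * X]/(bern n (fun k => a + b * (v \o S) k) y) ih; ring.
Qed.

Lemma bern_le n v w y : 0 <= y <= 1 -> (forall k, (k <= n)%N -> v k <= w k) ->
  bern n v y <= bern n w y.
Proof.
move=> /andP[y0 y1]; elim: n v w => [|n ih] v w vw /=; first exact: vw.
by rewrite lerD// ler_wpM2l ?subr_ge0// ih// => k kn; rewrite vw// ltnW.
Qed.

Lemma eq_bern n v w y : v =1 w -> bern n v y = bern n w y.
Proof.
by elim: n v w => [|n ih] v w vw //=;
  rewrite (ih v w)// (ih (v \o S) (w \o S))// => k /=.
Qed.

Lemma bernD n v w y : bern n (fun k => v k + w k) y = bern n v y + bern n w y.
Proof.
elim: n v w => [//|n ih] v w /=.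
rewrite (ih v) -[X in y * X]/(bern n (fun k => (v \o S) k + (w \o S) k) y) ih; ring.
Qed.

Lemma bernZ n v (b y : R) : bern n (fun k => b * v k) y = b * bern n v y.
Proof.
by rewrite -[RHS]add0r -bern_affine; apply: eq_bern => k; rewrite add0r.
Qed.

(** The variance n y (1 - y) of the binomial law: each trial adds y (1 - y), the
    cross term vanishing because a centred trial has mean 0. *)
Lemma bern_variance n y :
  bern n (fun k => (k%:R - n%:R * y) ^+ 2) y = n%:R * (y * (1 - y)).
Proof.
elim: n => [|n ih]; first by rewrite /= !mul0r subr0 expr0n.
pose u k : R := k%:R - n%:R * y.
have -> : bern n.+1 (fun k => (k%:R - n.+1%:R * y) ^+ 2) y =
  bern n (fun k => y * (1 - y) + 1 * u k ^+ 2) y.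
  rewrite /=.
  rewrite -!bernZ -bernD.
  by apply: eq_bern => k /=; rewrite /u -!natr1; ring.
by rewrite bern_affine ih -natr1; ring.
Qed.

(** Averaging the pointwise bound against the binomial law, where the quadratic
    term contributes its variance y (1 - y) / n <= 1 / (4 n). *)
Lemma bern_approx n v (h al be y : R) : 0 <= y <= 1 -> 0 <= be ->
  (forall k, (k <= n.+1)%N -> `|h - v k| <= al + be * (y - k%:R / n.+1%:R) ^+ 2) ->
  `|h - bern n.+1 v y| <= al + be / (4 * n.+1%:R).
Proof.
move=> y01 be0 hv; set N : R := n.+1%:R.
have N0 : 0 < N by rewrite ltr0n.
pose s k : R := (k%:R - N * y) ^+ 2.
have sE k : (y - k%:R / N) ^+ 2 = N ^- 2 * s k.
  by rewrite /s; field; rewrite gt_eqF.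
have bs : be * (N ^- 2 * (N * (y * (1 - y)))) <= be / (4 * N).
  rewrite ler_wpM2l// [leRHS]invfM.
  have -> : N ^- 2 * (N * (y * (1 - y))) = (y * (1 - y)) / N.
    by field; rewrite gt_eqF.
  rewrite ler_wpM2r ?invr_ge0 ?(ltW N0)//.
  have := sqr_ge0 (y - 2^-1); lra.
have up : bern n.+1 v y <= (h + al) + be * N ^- 2 * (N * (y * (1 - y))).
  rewrite -(bern_variance n.+1 y) -bern_affine; apply: bern_le => // k kn.
  have := hv _ kn; rewrite -/N sE mulrA -/(s k) ler_norml.
  by rewrite ?mulNr; move: (be * N ^- 2 * s k) => t; lra.
have lo : (h - al) + - (be * N ^- 2) * (N * (y * (1 - y))) <= bern n.+1 v y.
  rewrite -(bern_variance n.+1 y) -bern_affine; apply: bern_le => // k kn.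
  have := hv _ kn; rewrite -/N sE mulrA -/(s k) ler_norml.
  by rewrite ?mulNr; move: (be * N ^- 2 * s k) => t; lra.
rewrite (mulrA be) in bs; rewrite mulNr in lo; rewrite ler_norml.
move: (be * N ^- 2 * _) (be / (4 * N)) bs lo up => t t'.
lra.
Qed.

End bernstein.

(** * Approximation by Cauchy transforms *)
Section cauchy_approximation.
Context {R : realType}.
Local Notation mu := (@lebesgue_measure R).
Variables (a b : R) (J : set R) (dl : R).
Local Notation I := (`]a, b[%classic : set R).
Hypothesis dl0 : 0 < dl.
Hypothesis sep : forall t x, I t -> J x -> dl <= `|x - t|.
Implicit Types (f g : R -> R) (e B w x t : R) (n : nat).

(** g is within e, uniformly on J, of the Cauchy transform of a control on I
    bounded by B. The cost B is measured in sup norm, which adds up and scales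
    like the error. *)
Definition approx g e B := exists f, [/\ measurable_fun I f,
  forall t, I t -> `|f t| <= B &
  forall x, J x -> `|g x - \int[mu]_(t in I) (f t / (x - t))| <= e].

Let mI : measurable I. Proof. exact: measurable_itv. Qed.

Let fI : (mu I < +oo)%E.
Proof. by rewrite lebesgue_measure_itv /=; case: ifP => _; rewrite ltry. Qed.

Lemma separated_neq0 t x : I t -> J x -> x - t != 0.
Proof. by move=> It Jx; rewrite -normr_gt0 (lt_le_trans dl0)// sep. Qed.

Lemma separated_normV t x : I t -> J x -> `|(x - t)^-1| <= dl^-1.
Proof.
move=> It Jx.
by rewrite normfV lef_pV2 ?posrE ?normr_gt0 ?separated_neq0// sep.
Qed.

Lemma measurable_cauchy x : J x -> measurable_fun I (fun t => (x - t)^-1).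
Proof.
move=> Jx; apply: open_continuous_measurable_fun; first exact: interval_open.
move=> t /set_mem It; apply: cvgV; first exact: separated_neq0.
by apply: cvgB; [exact: cvg_cst|exact: cvg_id].
Qed.

Lemma integrable_cauchy f B x : J x -> measurable_fun I f ->
  (forall t, I t -> `|f t| <= B) ->
  mu.-integrable I (EFin \o (fun t => f t / (x - t))).
Proof.
move=> Jx mf fB; apply: integrableM_bounded => //.
- exact: integrable_bounded fB.
- exact: measurable_cauchy.
- by move=> t It; exact: separated_normV.
Qed.

Lemma approx_le g e B e' B' : e <= e' -> B <= B' -> approx g e B -> approx g e' B'.
Proof.
move=> ee BB [f [mf fB fe]]; exists f; split=> // [t It|x Jx].
  by rewrite (le_trans (fB _ It)).
by rewrite (le_trans (fe _ Jx)).
Qed.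

Lemma approx_near g g' e e' B : (forall x, J x -> `|g' x - g x| <= e') ->
  approx g e B -> approx g' (e + e') B.
Proof.
move=> gg [f [mf fB fe]]; exists f; split=> // x Jx.
have := ler_normD (g' x - g x) (g x - \int[mu]_(t in I) (f t / (x - t))).
by rewrite subrKA => /le_trans; apply; rewrite addrC lerD ?gg ?fe.
Qed.

Lemma approx_eq g g' e B : (forall x, J x -> g' x = g x) ->
  approx g e B -> approx g' e B.
Proof.
move=> gg [f [mf fB fe]]; exists f; split=> // x Jx.
by rewrite gg ?fe.
Qed.

Lemma approx0 : approx (fun=> 0) 0 0.
Proof.
exists (fun=> 0); split; first exact: measurable_cst.
- by move=> t _; rewrite normr0.
- move=> x Jx; under eq_Rintegral do rewrite mul0r.
  by rewrite Rintegral_cst// mul0r subrr normr0.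
Qed.

Lemma approxD g1 g2 e1 e2 B1 B2 : approx g1 e1 B1 -> approx g2 e2 B2 ->
  approx (fun x => g1 x + g2 x) (e1 + e2) (B1 + B2).
Proof.
move=> [f1 [mf1 fB1 fe1]] [f2 [mf2 fB2 fe2]].
exists (fun t => f1 t + f2 t); split.
- exact: measurable_funD.
- by move=> t It; rewrite (le_trans (ler_normD _ _))// lerD ?fB1 ?fB2.
move=> x Jx; under eq_Rintegral do rewrite mulrDl.
rewrite RintegralD//; [|exact: integrable_cauchy fB1|exact: integrable_cauchy fB2].
by rewrite opprD addrACA (le_trans (ler_normD _ _))// lerD ?fe1 ?fe2.
Qed.

Lemma approxZ g (k : R) e B : approx g e B ->
  approx (fun x => k * g x) (`|k| * e) (`|k| * B).
Proof.
move=> [f [mf fB fe]]; exists (fun t => k * f t); split.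
- by apply: measurable_funM => //; exact: measurable_cst.
- by move=> t It; rewrite normrM ler_wpM2l ?fB.
move=> x Jx; under eq_Rintegral do rewrite -mulrA.
rewrite RintegralZl//; last exact: integrable_cauchy fB.
by rewrite -mulrBr normrM ler_wpM2l ?fe.
Qed.

(** The control is the indicator of an interval of length w at tau, divided by
    w; on that interval the two kernels differ by at most w / dl^2. *)
Lemma approx_pole tau w : 0 < w -> I tau -> tau + w < b ->
  approx (fun x => (x - tau)^-1) (w / dl ^+ 2) w^-1.
Proof.
move=> w0 Itau tauwb.
pose E : set R := `]tau, tau + w[%classic.
have mE : measurable E by exact: measurable_itv.
have EI : E `<=` I.
  move=> t; move: Itau; rewrite /E /= !in_itv /= => /andP[atau _] /andP[tt tw].
  by rewrite (lt_trans atau)// (lt_trans tw).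
pose f t : R := w^-1 * \1_E t.
have mf : measurable_fun I f.
  by apply: measurable_funM; [exact: measurable_cst|exact: measurable_indic].
have f0 t : 0 <= f t.
  by rewrite mulr_ge0 ?invr_ge0 ?(ltW w0)// indicE; case: (_ \in _).
have fB t : `|f t| <= w^-1.
  rewrite ger0_norm// /f indicE; case: (_ \in _); rewrite ?mulr1 ?mulr0 ?invr_ge0//.
  exact: ltW.
have If : mu.-integrable I (EFin \o f).
  exact: integrable_bounded (fun t _ => fB t).
have i1 : mu.-integrable I (EFin \o (\1_E : R -> R)).
  apply: (@integrable_bounded _ _ _ 1) => //.
  by move=> t _; rewrite indicE; case: (_ \in _); rewrite ?normr1 ?normr0.
have intf : \int[mu]_(t in I) f t = 1.
  rewrite RintegralZl//.
  have muE : mu E = w%:E.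
    by rewrite /E lebesgue_measure_itv /= lte_fin ltrDl w0 -EFinB addrC addKr.
  rewrite /Rintegral integral_indic// setIidl// -[X in fine X]/(mu E) muE /=.
  by rewrite mulVf// gt_eqF.
exists f; split => // x Jx.
have icf : mu.-integrable I (EFin \o (fun t => f t / (x - t))).
  exact: integrable_cauchy (fun t _ => fB t).
have icx : mu.-integrable I (EFin \o (fun t => (x - tau)^-1 * f t)).
  exact: integrableZ_real.
rewrite -[X in X - _]mulr1 -intf -RintegralZl// -RintegralB//.
have idif : mu.-integrable I
    (EFin \o (fun t => (x - tau)^-1 * f t - f t / (x - t))).
  exact: integrableB_real.
apply: (le_trans (le_normr_Rintegral _ _)) => //.
apply: (@le_trans _ _ (\int[mu]_(t in I) (w / dl ^+ 2 * f t))); last first.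
  by rewrite RintegralZl// intf mulr1.
apply: le_Rintegral => //.
- exact: integrable_norm.
- exact: integrableZ_real.
move=> t It; rewrite (mulrC (f t)) -mulrBl normrM (ger0_norm (f0 t)).
have [tE|tE] := boolP (t \in E); last first.
  by rewrite /f indicE (negbTE tE) !mulr0.
rewrite ler_wpM2r//.
have -> : (x - tau)^-1 - (x - t)^-1 = (tau - t) * ((x - tau)^-1 * (x - t)^-1).
  by field; rewrite !separated_neq0.
rewrite normrM normrM; apply: ler_pM => //.
  move: tE; rewrite inE /E /= in_itv /= => /andP[? ?].
  rewrite ler_norml; lra.
by rewrite expr2 invfM ler_pM// separated_normV.
Qed.

Variables (eta w : R) (kappa m : R) (N : nat).
Hypothesis eta0 : 0 < eta.
Hypothesis w0 : 0 < w.
Hypothesis kappadl : `|kappa| = dl.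
Hypothesis am : a < m.
Hypothesis mb : m + N%:R * eta + w < b.
Hypothesis etadl : eta <= dl.

(** The product of n normalized Cauchy kernels with equally spaced poles. *)
Definition poles n tau x : R := \prod_(i < n) (kappa / (x - (tau + i%:R * eta))).

Local Notation Q := (2 * dl / eta).

Let Q1 : 1 <= Q.
Proof.
rewrite ler_pdivlMr// mul1r (le_trans etadl)// ler_peMl// ?ler1n//; exact: ltW.
Qed.

Let I_node j : (j <= N)%N -> I (m + j%:R * eta).
Proof.
move=> jN; rewrite /= in_itv /=.
have : 0 <= j%:R * eta by rewrite mulr_ge0// ltW.
have : j%:R * eta <= N%:R * eta by rewrite ler_wpM2r ?ler_nat// ltW.
by move: mb w0 am; lra.
Qed.

(** This is the recursion of divided differences, in the partial fraction form
    1 / (A C) = (1 / A - 1 / C) / (C - A) applied to the extreme factors. *)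
Lemma polesS n tau x : (forall i, (i <= n.+1)%N -> x - (tau + i%:R * eta) != 0) ->
  poles n.+2 tau x =
  kappa / (n.+1%:R * eta) * (poles n.+1 (tau + eta) x - poles n.+1 tau x).
Proof.
move=> x0; rewrite /poles.
have -> : \prod_(i < n.+1) (kappa / (x - (tau + eta + i%:R * eta))) =
    \prod_(i < n.+1) (kappa / (x - (tau + i.+1%:R * eta))).
  by apply: eq_bigr => i _; rewrite -natr1 mulrDl mul1r addrAC addrA addrAC.
pose F i := kappa / (x - (tau + i%:R * eta)); pose P := \prod_(i < n) F i.+1.
have -> : \prod_(i < n.+2) F i = F 0%N * (P * F n.+1).
  by rewrite big_ord_recl big_ord_recr.
have -> : \prod_(i < n.+1) F i.+1 = P * F n.+1 by rewrite big_ord_recr.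
have -> : \prod_(i < n.+1) F i = F 0%N * P by rewrite big_ord_recl.
have := x0 0%N isT; have := x0 n.+1 (leqnn _); rewrite /F mul0r addr0 => h1 h0.
have n1 : n.+1%:R != 0 :> R by rewrite pnatr_eq0.
move: (n.+1%:R : R) (P) h1 n1 => M P' h1 n1.
by field; rewrite h1 h0 n1 gt_eqF.
Qed.

(** Each divided difference multiplies both the error and the cost by at most
    Q = 2 dl / eta. *)
Lemma approx_poles n j : (n + j <= N)%N ->
  approx (poles n.+1 (m + j%:R * eta)) (Q ^+ n * (w / dl)) (Q ^+ n * (dl / w)).
Proof.
elim: n j => [|n ih] j njN.
  rewrite !mul1r.
  have jN : (j <= N)%N by [].
  have tw : m + j%:R * eta + w < b.
    apply: le_lt_trans mb; rewrite lerD2r lerD2l ler_wpM2r ?ler_nat//; exact: ltW.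
  have := approxZ kappa (approx_pole w0 (I_node jN) tw).
  rewrite kappadl; have -> : dl * (w / dl ^+ 2) = w / dl by field; rewrite gt_eqF.
  apply: approx_eq => x Jx.
  by rewrite /poles big_ord1 mul0r addr0.
have n1 : 0 < n.+1%:R * eta by rewrite mulr_gt0// ltr0n.
have hj : (n + j.+1 <= N)%N by rewrite addnS -addSn.
have hj' : (n + j <= N)%N by rewrite (leq_trans _ njN)// addSn.
have := approxZ (kappa / (n.+1%:R * eta))
  (approxD (ih _ hj) (approxZ (-1) (ih _ hj'))).
rewrite normrN1 !mul1r -!mulr2n => A.
apply: (approx_eq (g := fun x => kappa / (n.+1%:R * eta) *
  (poles n.+1 (m + j.+1%:R * eta) x + -1 * poles n.+1 (m + j%:R * eta) x))).
  move=> x Jx; rewrite polesS.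
    have -> : m + j.+1%:R * eta = m + j%:R * eta + eta by rewrite -natr1; ring.
    by rewrite mulN1r.
  move=> i iN; rewrite -addrA -mulrDl -natrD separated_neq0//.
  apply: I_node; apply: leq_trans njN; rewrite addnC leq_add2r//.
have kQ : `|kappa / (n.+1%:R * eta)| * 2 <= Q.
  rewrite normrM kappadl normfV (gtr0_norm n1) mulrC mulrA ler_pM2l ?mulr_gt0//.
  rewrite lef_pV2 ?posrE// ler_peMl ?ler1n//; exact: ltW.
have Q0 : 0 <= Q by rewrite (le_trans _ Q1).
have scale t : 0 <= t ->
    `|kappa / (n.+1%:R * eta)| * (Q ^+ n * t *+ 2) <= Q ^+ n.+1 * t.
  move=> t0; rewrite exprS -(mulrA Q) -(mulr_natl (Q ^+ n * t)).
  rewrite [leLHS]mulrA.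
  by rewrite ler_wpM2r// mulr_ge0// exprn_ge0.
by apply: approx_le A; apply: scale; rewrite divr_ge0// ltW.
Qed.

(** The coordinate in which the powers are limits of products of poles. *)
Definition inv_coord x : R := kappa / (x - m).
Local Notation y := inv_coord.

Let normr_node j x : (j <= N)%N -> J x -> `|kappa / (x - (m + j%:R * eta))| <= 1.
Proof.
move=> jN Jx; rewrite normrM kappadl -ler_pdivlMl// mulr1.
exact: separated_normV (I_node jN) Jx.
Qed.

(** Products of factors of modulus at most 1 differ by at most the sum of the
    differences of the factors. *)
Lemma poles_near n x : (n <= N)%N -> J x ->
  `|y x ^+ n - poles n m x| <= n%:R * (N%:R * eta / dl).
Proof.
move=> + Jx; elim: n => [|n ih] nN.
  by rewrite /poles big_ord0 subrr normr0 mul0r.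
rewrite /poles big_ord_recr /= -/(poles n m x) exprSr.
set q := kappa / _.
have q1 : `|q| <= 1 by apply: normr_node => //; exact: ltnW.
have y1 : `|y x| <= 1 by have := normr_node (leq0n N) Jx; rewrite mul0r addr0.
have yq : `|y x - q| <= N%:R * eta / dl.
  have I0 : I m by have := I_node (leq0n N); rewrite mul0r addr0.
  have In : I (m + n%:R * eta) by apply: I_node; exact: ltnW.
  have -> : y x - q = y x * (x - (m + n%:R * eta))^-1 * - (n%:R * eta).
    rewrite /inv_coord /q; field.
    by rewrite (separated_neq0 I0 Jx) (separated_neq0 In Jx).
  have ne0 : 0 <= n%:R * eta by rewrite mulr_ge0// ltW.
  rewrite normrM normrN (ger0_norm ne0) normrM mulrC.
  apply: ler_pM; rewrite ?mulr_ge0 ?(ltW eta0)//.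
    by rewrite ler_wpM2r ?ler_nat ?(ltW eta0)// ltnW.
  rewrite -[dl^-1]mul1r ler_pM//; exact: separated_normV In Jx.
have -> : y x ^+ n * y x - poles n m x * q =
  (y x ^+ n - poles n m x) * q + y x ^+ n * (y x - q) by ring.
rewrite (le_trans (ler_normD _ _))// -(natr1 n) (mulrDl n%:R) mul1r lerD//.
  by rewrite normrM (le_trans (ler_piMr _ q1))// ih// ltnW.
by rewrite normrM (le_trans (ler_piMl _ _))// normrX exprn_ile1.
Qed.

Let e0 := Q ^+ N * (w / dl) + N%:R * (N%:R * eta / dl).
Let B0 := Q ^+ N * (dl / w).

Lemma approx_power n : (0 < n)%N -> (n <= N)%N -> approx (fun x => y x ^+ n) e0 B0.
Proof.
case: n => // n _ nN.
have A : approx (poles n.+1 m) (Q ^+ n * (w / dl)) (Q ^+ n * (dl / w)).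
  have := @approx_poles n 0; rewrite addn0 mul0r addr0; apply; exact: ltnW.
have QN : Q ^+ n <= Q ^+ N by rewrite ler_weXn2l// ltnW.
have near : forall x, J x ->
    `|y x ^+ n.+1 - poles n.+1 m x| <= N%:R * (N%:R * eta / dl).
  move=> x Jx; rewrite (le_trans (poles_near nN Jx))// ler_wpM2r ?ler_nat//.
  by rewrite divr_ge0 ?mulr_ge0 ?(ltW eta0) ?(ltW dl0).
apply: approx_le (approx_near near A).
- by rewrite lerD2r ler_wpM2r// divr_ge0// ltW.
- by rewrite ler_wpM2r// divr_ge0// ltW.
Qed.

(** The recursion of [bern] expresses y^j bern_(n+1) by three terms of order n,
    whence the factor 3^n. The power j keeps the induction inside functions of y
    without constant term: only when j = 0 must v vanish at 0. *)
Lemma approx_bern n j (v : nat -> R) (V : R) : (n + j <= N)%N ->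
  (forall k : nat, (k <= n)%N -> `|v k| <= V) -> (j = 0%N -> v 0%N = 0) ->
  approx (fun x => y x ^+ j * bern n v (y x))
    (3 ^+ n * (V * e0)) (3 ^+ n * (V * B0)).
Proof.
have e00 : 0 <= e0.
  by rewrite addr_ge0 ?mulr_ge0 ?exprn_ge0 ?mulr_ge0 ?invr_ge0
    ?(ltW eta0) ?(ltW dl0) ?(ltW w0).
have B00 : 0 <= B0.
  by rewrite mulr_ge0 ?exprn_ge0 ?divr_ge0 ?mulr_ge0 ?(ltW eta0) ?(ltW dl0) ?(ltW w0).
elim: n j v => [|n ih] j v njN vV v0.
  rewrite !mul1r /=; have V0 := vV 0%N isT.
  have [j0|j0] := posnP j.
    apply: (approx_eq (g := fun=> 0)) => [x _|]; first by rewrite v0// mulr0.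
    apply: approx_le approx0; rewrite mulr_ge0//; exact: le_trans (normr_ge0 _) V0.
  apply: (approx_eq (g := fun x => v 0%N * y x ^+ j)) => [x _|].
    by rewrite mulrC.
  by apply: approx_le (approxZ _ (approx_power j0 njN)); rewrite ler_wpM2r.
have njN' : (n + j <= N)%N by rewrite (leq_trans _ njN)// addSn.
have njN1 : (n + j.+1 <= N)%N by rewrite addnS -addSn.
have vV' (k : nat) : (k <= n)%N -> `|v k| <= V by move=> kn; rewrite vV// ltnW.
(* The shifted sequence need not vanish at 0, but it comes with a factor y. *)
have A1 := ih j.+1 (v \o S) njN1
  (fun k kn => vV k.+1 kn) (fun h => ltac:(discriminate h)).
have A2 := ih j v njN' vV' v0.
have A3 := ih j.+1 v njN1 vV' (fun h => ltac:(discriminate h)).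
apply: (approx_eq (g := fun x => y x ^+ j.+1 * bern n (v \o S) (y x) +
   (y x ^+ j * bern n v (y x) + -1 * (y x ^+ j.+1 * bern n v (y x))))).
  by move=> x _ /=; rewrite exprSr; ring.
apply: approx_le (approxD A1 (approxD A2 (approxZ (-1) A3))).
- by rewrite normrN1 exprS; set t := 3 ^+ n * _; rewrite -mulrA -/t; lra.
- by rewrite normrN1 exprS; set t := 3 ^+ n * _; rewrite -mulrA -/t; lra.
Qed.

End cauchy_approximation.

(** * The Hilbert transform away from the support *)
Section hilbert_separated.
Context {R : realType}.
Local Notation mu := (@lebesgue_measure R).
Variables (a b c d dl : R).
Local Notation I := (`]a, b[%classic : set R).
Local Notation J := (`]c, d[%classic : set R).
Hypothesis dl0 : 0 < dl.
Hypothesis sep : forall t x, I t -> J x -> dl <= `|x - t|.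
Implicit Types (f h : R -> R) (x t B : R).

(** The truncation is inactive as soon as it is smaller than the distance. *)
Lemma hilbert_onE f x : J x -> hilbert_on I f x = \int[mu]_(t in I) (f t / (x - t)).
Proof.
move=> Jx; rewrite /hilbert_on /hilbert.
apply: lim_near_cst => //; near=> e.
have e_dl : e < dl by near: e; exact: nbhs_right_lt.
rewrite /truncated_hilbert Rintegral_mkcond [RHS]Rintegral_mkcond.
congr Rintegral; apply/funext => t; rewrite /patch.
case: ifPn => [te|te]; case: ifPn => tI //; first by rewrite mul0r.
exfalso; move/negP: te; apply; rewrite inE /=.
by apply: (lt_le_trans e_dl); apply: sep => //; exact/set_mem.
Unshelve. all: by end_near. Qed.

(** The kernel is Lipschitz in x uniformly in t, so that the transform is
    continuous on the open interval J. *)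
Lemma measurable_hilbert_on f B : measurable_fun I f ->
  (forall t, I t -> `|f t| <= B) -> measurable_fun J (hilbert_on I f).
Proof.
move=> mf fB.
have fI : (mu I < +oo)%E.
  by rewrite lebesgue_measure_itv /=; case: ifP => _; rewrite ltry.
have mI : measurable I by exact: measurable_itv.
pose l := fine (mu I).
have l0 : 0 <= l by rewrite fine_ge0.
pose K := `|B| * (dl^-1 * dl^-1) * l.
have K0 : 0 <= K by rewrite !mulr_ge0// invr_ge0 ltW.
have lip x x' : J x -> J x' ->
    `|hilbert_on I f x - hilbert_on I f x'| <= K * `|x - x'|.
  move=> Jx Jx'; rewrite !hilbert_onE//.
  rewrite -RintegralB//; [|exact: integrable_cauchy dl0 sep _ _ _ Jx mf fB
                          |exact: integrable_cauchy dl0 sep _ _ _ Jx' mf fB].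
  have id : mu.-integrable I (EFin \o (fun t => f t / (x - t) - f t / (x' - t))).
    by apply: integrableB_real => //; 
      [exact: integrable_cauchy dl0 sep _ _ _ Jx mf fB
      |exact: integrable_cauchy dl0 sep _ _ _ Jx' mf fB].
  apply: (le_trans (le_normr_Rintegral _ _)) => //.
  apply: (@le_trans _ _ (\int[mu]_(t in I) (`|B| * (dl^-1 * dl^-1) * `|x - x'|))).
    apply: le_Rintegral => //.
    - exact: integrable_norm.
    - exact: integrable_cst.
    - move=> t It.
      have -> : f t / (x - t) - f t / (x' - t) =
        f t * ((x - t)^-1 * (x' - t)^-1) * (x' - x).
        field.
        by rewrite (separated_neq0 dl0 sep It Jx) (separated_neq0 dl0 sep It Jx').
      rewrite normrM (distrC x') ler_wpM2r// normrM normrM.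
      apply: ler_pM => //; first by rewrite (le_trans (fB _ It))// ler_norm.
      by apply: ler_pM => //; exact: (separated_normV dl0 sep).
  by rewrite Rintegral_cst// -/l /K mulrAC.
apply: open_continuous_measurable_fun; first exact: interval_open.
move=> x /set_mem Jx; have oJ : open J by exact: interval_open.
have nJ := open_nbhs_nbhs (conj oJ Jx).
apply/cvgrPdist_le => e e0; near=> x'.
have Jx' : J x'.
  by near: x'; exact: nJ.
apply: (le_trans (lip _ _ Jx Jx')).
apply: (@le_trans _ _ ((K + 1) * `|x - x'|)); first by rewrite ler_wpM2r// lerDl.
rewrite mulrC -ler_pdivlMr ?ltr_wpDl//.
near: x'; apply/nbhs_normP; exists (e / (K + 1)) => /= [|x' /ltW//].
by rewrite divr_gt0// ltr_wpDl.
Unshelve. all: by end_near. Qed.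

End hilbert_separated.

(** * Separated intervals *)
Section geometry.
Context {R : realType}.
Implicit Types a b c d t x : R.

Lemma mem_closure_itvoo a b x : a < b -> a <= x <= b -> closure `]a, b[ x.
Proof.
move=> ab /andP[ax xb] B /nbhs_normP[e /= e0 eB].
have ba0 : 0 < b - a by rewrite subr_gt0.
pose t := Num.min 1 (e / (b - a)).
have t0 : 0 < t by rewrite lt_min ltr01 divr_gt0.
have t1 : t <= 1 by rewrite ge_min lexx.
have te : t * (b - a) <= e by rewrite -ler_pdivlMr// ge_min lexx orbT.
have tba : 0 < t * (b - a) by rewrite mulr_gt0.
have t1x : 0 <= (1 - t) * (x - a) by rewrite mulr_ge0 ?subr_ge0.
have t1y : 0 <= (1 - t) * (b - x) by rewrite mulr_ge0 ?subr_ge0.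
have tx : 0 <= t * (x - a) by rewrite mulr_ge0 ?subr_ge0// ltW.
have ty : 0 <= t * (b - x) by rewrite mulr_ge0 ?subr_ge0// ltW.
exists ((1 - t) * x + t * ((a + b) / 2)); split.
  rewrite /= in_itv /=; apply/andP; split; lra.
apply: eB => /=; rewrite ltr_norml; apply/andP; split; lra.
Qed.

Lemma separated_intervals a b c d : a < b -> c < d ->
  closure `]a, b[ `&` closure `]c, d[ = set0 -> b < c \/ d < a.
Proof.
move=> ab cd disj.
have [bc|cb] := ltP b c; first by left.
have [da|ad] := ltP d a; first by right.
exfalso; suff : set0 (Num.max a c) by [].
rewrite -disj; split; apply: mem_closure_itvoo => //.
  by rewrite le_max lexx ge_max (ltW ab) cb.
by rewrite le_max lexx orbT ge_max ad (ltW cd).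
Qed.

(** The sign sg accounts for the two possible positions of J relative to I. *)
Lemma set_dist_separated a b c d : a < b -> c < d ->
  closure `]a, b[ `&` closure `]c, d[ = set0 ->
  let dl := set_dist `]a, b[%classic `]c, d[%classic in
  [/\ 0 < dl,
      forall t x, `]a, b[%classic t -> `]c, d[%classic x -> dl <= `|x - t|,
      forall t x, `]a, b[%classic t -> `]c, d[%classic x ->
        `|x - t| <= (b - a) + (d - c) + dl
    & exists sg : R, `|sg| = 1 /\ forall t x,
        `]a, b[%classic t -> `]c, d[%classic x -> sg * (x - t) = `|x - t| ].
Proof.
move=> ab cd disj dl.
have lb t x : `]a, b[%classic t -> `]c, d[%classic x -> dl <= `|x - t|.
  move=> It Jx; apply: inf_lbound; last first.
    by exists t => //; exists x => //; rewrite distrC.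
  by exists 0 => _ [? _ [? _ <-]].
have ne : [set `|x - y| | x in `]a, b[ & y in `]c, d[] !=set0.
  exists `|(a + b) / 2 - (c + d) / 2|.
  exists ((a + b) / 2); first by rewrite /= in_itv /=; lra.
  exists ((c + d) / 2) => //; rewrite /= in_itv /=; lra.
have [bc|da] := separated_intervals ab cd disj.
  have cbdl : c - b <= dl.
    apply: lb_le_inf => // _ [t + [x + <-]]; rewrite /= !in_itv /=.
    move=> /andP[? ?] /andP[? ?]; rewrite ltr0_norm; lra.
  have pos t x : `]a, b[%classic t -> `]c, d[%classic x -> 0 < x - t.
    by rewrite /= !in_itv /=; lra.
  split => //; first by lra.
    move=> t x It Jx; rewrite gtr0_norm ?pos//.
    by move: It Jx; rewrite /= !in_itv /=; lra.
  exists 1; split; first by rewrite normr1.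
  by move=> t x It Jx; rewrite mul1r gtr0_norm ?pos.
have addl : a - d <= dl.
  apply: lb_le_inf => // _ [t + [x + <-]]; rewrite /= !in_itv /=.
  move=> /andP[? ?] /andP[? ?]; rewrite gtr0_norm; lra.
have neg t x : `]a, b[%classic t -> `]c, d[%classic x -> x - t < 0.
  by rewrite /= !in_itv /=; lra.
split => //; first by lra.
  move=> t x It Jx; rewrite ltr0_norm ?neg//.
  by move: It Jx; rewrite /= !in_itv /=; lra.
exists (- 1); split; first by rewrite normrN1.
by move=> t x It Jx; rewrite mulN1r ltr0_norm ?neg.
Qed.

End geometry.

(** * Bernstein approximation on the good points *)
Section bernstein_on_good_points.
Context {R : realType}.
Implicit Types (D : set R) (h y : R -> R).

Definition bernstein_const (La Bs ymin : R) : R :=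
  32 * La + 128 * La ^+ 2 + 2 * Bs / ymin ^+ 2.

(** The nodes k/n may lie outside the range of y. A point z of D whose coordinate
    nearly realizes the distance of q to the range serves in place of q. *)
Lemma bernstein_nodes D y n : D !=set0 -> (0 < n)%N ->
  forall q : R, exists2 z, D z &
    forall x, D x -> `|y x - y z| <= 2 * `|y x - q| + n%:R^-1.
Proof.
move=> [x0 Dx0] n0 q; pose S := [set `|y z - q| | z in D].
have infS : has_inf S.
  split; first by exists `|y x0 - q|; exists x0.
  by exists 0 => _ [z _ <-].
have n1 : 0 < n%:R^-1 :> R by rewrite invr_gt0 ltr0n.
have [_ [z Dz <-] zlt] := inf_adherent n1 infS.
exists z => // x Dx.
have xge : inf S <= `|y x - q| by apply: inf_lbound; [exact: infS.2|exists x].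
have := ler_distD q (y x) (y z); rewrite (distrC q); lra.
Qed.

(** Each of the error terms is O(M / r): s = 1 / (8 M r) makes s M^2 = M / (8 r),
    the slack th = 1 / (32 La r^2) splits the modulus of continuity between a
    constant and a quadratic term in y x - k/n, and the quadratic terms are
    divided by n. The value 0 given at k = 0 is acceptable since y stays above
    ymin, so that the error Bs M there is at most Bs M (y x / ymin)^2. *)
Lemma bernstein_good_points D h y (M La Bs ymin r : R) n :
  D !=set0 -> 0 < M -> 0 < La -> 0 < Bs -> 0 < ymin -> 1 <= r ->
  (forall x z s, D x -> D z -> 0 < s ->
    `|h x - h z| <= s * M ^+ 2 + `|x - z| / (4 * s)) ->
  (forall z, D z -> `|h z| <= Bs * M) ->
  (forall x z, D x -> D z -> `|x - z| <= La * `|y x - y z|) ->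
  (forall x, D x -> ymin <= y x <= 1) ->
  bernstein_const La Bs ymin * r ^+ 4 <= n.+1%:R ->
  exists v : nat -> R, [/\ v 0%N = 0, forall k, `|v k| <= Bs * M &
    forall x, D x -> `|h x - bern n.+1 v (y x)| <= M / (2 * r)].
Proof.
move=> D0 M0 La0 Bs0 ym0 r1 mod hB yLip y01 nbig.
set N : R := n.+1%:R in nbig *.
have N0 : 0 < N by rewrite ltr0n.
have r0 : 0 < r by rewrite (lt_le_trans _ r1).
have [M0' La0' Bs0'] : [/\ 0 <= M, 0 <= La & 0 <= Bs] by rewrite !ltW.
have [ym0' r0' N0'] : [/\ 0 <= ymin, 0 <= r & 0 <= N] by rewrite !ltW.
have /choice[z hz] : forall k : nat, exists z, D z /\
    forall x, D x -> `|y x - y z| <= 2 * `|y x - k%:R / N| + N^-1.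
  move=> k; have [z ? ?] := @bernstein_nodes D y n.+1 D0 isT (k%:R / N).
  by exists z.
pose v k := if k is 0%N then 0 else h (z k).
exists v; split => //.
  move=> [|k]; first by rewrite normr0 mulr_ge0 //.
  by apply: hB; exact: (hz k.+1).1.
move=> x Dx.
pose s := (8 * M * r)^-1.
have s0 : 0 < s by rewrite invr_gt0 !mulr_gt0.
pose th := (32 * La * r ^+ 2)^-1.
have th0 : 0 < th by rewrite invr_gt0 !mulr_gt0// exprn_gt0.
have [s0' th0'] : 0 <= s /\ 0 <= th by rewrite !ltW.
pose al := s * M ^+ 2 + La / (4 * s) * (th + N^-1).
pose be := La / (4 * s) / th + Bs * M / ymin ^+ 2.
have be0 : 0 <= be.
  by rewrite addr_ge0// !mulr_ge0 ?invr_ge0 ?mulr_ge0 ?exprn_ge0 //.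
have [ym yx1] := andP (y01 _ Dx).
have yx0 : 0 <= y x by rewrite (le_trans _ ym).
have := @bern_approx R n v (h x) al be (y x).
rewrite yx0 yx1 => /(_ isT be0) main.
apply: le_trans (main _) _.
  move=> [|k] _.
    rewrite /v subr0 mul0r subr0 (le_trans (hB _ Dx))//.
    have : Bs * M <= Bs * M / ymin ^+ 2 * y x ^+ 2.
      rewrite mulrAC ler_pdivlMr ?exprn_gt0// ler_wpM2l ?mulr_ge0 //.
      by rewrite ler_sqr ?nnegrE ?yx0//.
    have : 0 <= al.
      rewrite addr_ge0 ?mulr_ge0 ?addr_ge0 ?invr_ge0 ?mulr_ge0 ?exprn_ge0 //.
    have : 0 <= La / (4 * s) / th * y x ^+ 2.
      by rewrite !mulr_ge0 ?invr_ge0 ?mulr_ge0 ?exprn_ge0 ?yx0//.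
    rewrite /be mulrDl; lra.
  have [Dz zk] := hz k.+1.
  apply: le_trans (mod _ _ s Dx Dz s0) _.
  rewrite -addrA lerD2l -/N; set u := y x - _.
  have s4 : 0 <= (4 * s)^-1 by rewrite invr_ge0 mulr_ge0// ltW.
  apply: (@le_trans _ _ (La / (4 * s) * (2 * `|u| + N^-1))).
    rewrite mulrAC ler_wpM2r//.
    by apply: le_trans (yLip _ _ Dx Dz) _; rewrite ler_wpM2l ?(ltW La0)// zk.
  (* Square completion trades the linear term for a quadratic one. *)
  have amgm : 2 * `|u| <= th + th^-1 * u ^+ 2.
    rewrite -subr_ge0.
    have -> : th + th^-1 * u ^+ 2 - 2 * `|u| = th^-1 * (th - `|u|) ^+ 2.
      by rewrite -(real_normK (num_real u)); field; rewrite gt_eqF.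
    by rewrite mulr_ge0 ?sqr_ge0// invr_ge0 ltW.
  have LaS : 0 <= La / (4 * s) by rewrite mulr_ge0// ltW.
  have := ler_wpM2l LaS amgm.
  have : 0 <= Bs * M / ymin ^+ 2 * u ^+ 2.
    by rewrite mulr_ge0 ?sqr_ge0// divr_ge0 ?exprn_ge0// mulr_ge0.
  rewrite /be; move: (La / (4 * s)) (Bs * M / ymin ^+ 2) LaS (th^-1) (N^-1).
  by move=> kk W _ th' N'; lra.
have rr2 : r <= r ^+ 4 by rewrite -[leLHS]expr1 ler_weXn2l.
have rr4 : r ^+ 2 <= r ^+ 4 by rewrite ler_weXn2l.
have hN : N^-1 * (bernstein_const La Bs ymin * r ^+ 4) <= 1.
  by rewrite mulrC ler_pdivrMr// mul1r.
have t1 : 0 <= La * N^-1 by rewrite mulr_ge0 ?invr_ge0 //.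
have t2 : 0 <= Bs / ymin ^+ 2 * N^-1 by rewrite !mulr_ge0 ?invr_ge0 ?exprn_ge0 //.
have -> : al + be / (4 * N) = M / r * (8^-1 + 16^-1 +
    2 * (La * N^-1 * r ^+ 2) + 16 * (La ^+ 2 * N^-1 * r ^+ 4) +
    4^-1 * (Bs / ymin ^+ 2 * N^-1 * r)).
  by rewrite /al /be /s /th; field; rewrite !gt_eqF.
have -> : M / (2 * r) = M / r * 2^-1 by rewrite invfM mulrA mulrAC.
rewrite ler_wpM2l ?divr_ge0 ?mulr_ge0//.
have := ler_wpM2l t1 rr4; have := ler_wpM2l t2 rr2.
have t3 : 0 <= La ^+ 2 * N^-1 * r ^+ 4.
  by rewrite !mulr_ge0 ?invr_ge0 ?exprn_ge0 //.
move: hN; rewrite /bernstein_const.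
have -> : N^-1 * ((32 * La + 128 * La ^+ 2 + 2 * Bs / ymin ^+ 2) * r ^+ 4) =
  32 * (La * N^-1 * r ^+ 4) + 128 * (La ^+ 2 * N^-1 * r ^+ 4) +
  2 * (Bs / ymin ^+ 2 * N^-1 * r ^+ 4) by ring.
have t4 : 0 <= La * N^-1 * r ^+ 4 by rewrite !mulr_ge0 ?invr_ge0 ?exprn_ge0.
move: t3 t4 {t1 t2}; move: (La * N^-1 * r ^+ 4) (La ^+ 2 * N^-1 * r ^+ 4)
  (Bs / ymin ^+ 2 * N^-1 * r ^+ 4) (La * N^-1 * r ^+ 2)
  (Bs / ymin ^+ 2 * N^-1 * r) => X Y Z X2 Z1; lra.
Qed.

End bernstein_on_good_points.

(** * The constants *)
Section constants.
Context {R : realType}.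
Implicit Types A L dl Bs p r x : R.

(** Large enough for exp p to dominate both 4 Bs and 8 dl / A. *)
Definition exponent A dl Bs : R := 4 * Bs + 8 * dl / A.

(** All quantities are compared with exponentials: x = N is at least 1 and bounds
    r, so x and r are at most exp x, 3^N at most exp (2 x), and Q^N at most
    exp ((p + 6) x^2). The width w, of exponent of order x^2, absorbs Q^N; the
    spacing eta, of exponent of order x, absorbs 3^N. *)
Lemma cauchy_constants A dl Bs r (N : nat) : 0 < A -> 0 < dl -> 0 < Bs ->
  1 <= r -> r <= N%:R ->
  let p := exponent A dl Bs in
  let eta := dl * expR (- ((p + 5) * N%:R)) in
  let w := dl * expR (- ((2 * p + 9) * N%:R ^+ 2)) in
  let Q := 2 * dl / eta in
  [/\ eta <= dl, N%:R * eta + w < A / 2,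
    3 ^+ N * (Bs * (Q ^+ N * (w / dl) + N%:R * (N%:R * eta / dl))) <= (2 * r)^-1
    & 3 ^+ N * (Bs * (Q ^+ N * (dl / w))) <= expR ((4 * p + 17) * N%:R ^+ 2)].
Proof.
move=> A0 dl0 Bs0 r1 rN p eta w Q.
set x : R := N%:R in rN eta w Q *.
have x1 : 1 <= x by rewrite (le_trans r1).
have x0 : 0 <= x by rewrite (le_trans _ x1).
have r0 : 0 < r by rewrite (lt_le_trans _ r1).
have dlA : 0 <= 8 * dl / A by rewrite divr_ge0 ?mulr_ge0 ?(ltW dl0) ?(ltW A0).
have [A0' dl0' Bs0'] : [/\ 0 <= A, 0 <= dl & 0 <= Bs] by rewrite !ltW.
have p0 : 0 <= p by rewrite addr_ge0// mulr_ge0.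
have xx : x <= x ^+ 2 by rewrite expr2 ler_peMl.
have xx1 : 1 <= x ^+ 2 by rewrite (le_trans x1).
have xx0 : 0 <= x ^+ 2 by rewrite sqr_ge0.
have pEp : p <= expR p by have := expR_ge1Dx p; lra.
have Bsp : Bs <= expR p / 4.
  by move: pEp; rewrite {1}/p /exponent; move: (8 * dl / A) dlA => t; lra.
have dlp : dl * expR (- p) <= A / 8.
  rewrite expRN ler_pdivrMr ?expR_gt0//.
  have : A / 8 * (8 * dl / A) <= A / 8 * expR p.
    rewrite ler_wpM2l ?divr_ge0//; apply: le_trans pEp.
    by rewrite lerDr mulr_ge0.
  by have -> : A / 8 * (8 * dl / A) = dl by field; rewrite gt_eqF.
have xEx : x <= expR x by have := expR_ge1Dx x; lra.
have E2 : 2 <= expR 1 :> R by have := expR_ge1Dx (1 : R); lra.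
have E3 : 3 <= expR 2 :> R by have := expR_ge1Dx (2 : R); lra.
have eta0 : 0 < eta by rewrite mulr_gt0// expR_gt0.
have QE : Q = 2 * expR ((p + 5) * x).
  rewrite /Q /eta expRN; field.
  by rewrite !gt_eqF// expR_gt0.
have Q0 : 0 <= Q by rewrite QE mulr_ge0// expR_ge0.
have QN : Q ^+ N <= expR ((p + 6) * x ^+ 2).
  have -> : (p + 6) * x ^+ 2 = (p + 6) * x * x by ring.
  rewrite expRM_natr lerXn2r ?nnegrE ?expR_ge0//.
  rewrite QE; apply: (@le_trans _ _ (expR x * expR ((p + 5) * x))).
    by rewrite ler_wpM2r ?expR_ge0// (le_trans E2)// ler_expR.
  by rewrite -expRD ler_expR; lra.
have N3 : 3 ^+ N <= expR (2 * x).
  by rewrite expRM_natr lerXn2r ?nnegrE ?expR_ge0.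
have etadl : eta / dl = expR (- ((p + 5) * x)).
  by rewrite /eta mulrAC divff ?mul1r// gt_eqF.
have wdl : w / dl = expR (- ((2 * p + 9) * x ^+ 2)).
  by rewrite /w mulrAC divff ?mul1r// gt_eqF.
have dlw : dl / w = expR ((2 * p + 9) * x ^+ 2).
  by rewrite -[LHS]invrK invfM invrK mulrC wdl expRN invrK.
have p5x : 0 <= (p + 5) * x by rewrite mulr_ge0// addr_ge0.
have N30 : 0 <= 3 ^+ N :> R by rewrite exprn_ge0.
have QN0 : 0 <= Q ^+ N by rewrite exprn_ge0.
have px : p <= p * x by rewrite ler_peMr.
have pxx : p * x <= p * x ^+ 2 by rewrite ler_wpM2l.
have Er : expR (- x) <= r^-1.
  by rewrite expRN lef_pV2 ?posrE ?expR_gt0// (le_trans rN).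
split.
- by rewrite ger_pMr// expR_le1 oppr_le0.
- have h1 : x * eta <= A / 8.
    apply: le_trans dlp; rewrite /eta mulrCA ler_wpM2l ?(ltW dl0)//.
    apply: (@le_trans _ _ (expR x * expR (- ((p + 5) * x)))).
      by rewrite ler_wpM2r ?expR_ge0.
    by rewrite -expRD ler_expR; lra.
  have h2 : w <= A / 8.
    apply: le_trans dlp; rewrite /w ler_wpM2l ?(ltW dl0)// ler_expR.
    rewrite lerN2; lra.
  by lra.
- have first : 3 ^+ N * (Bs * (Q ^+ N * (w / dl))) <= expR (- x) / 4.
    apply: (@le_trans _ _ (expR (2 * x) * (expR p / 4 *
      (expR ((p + 6) * x ^+ 2) * expR (- ((2 * p + 9) * x ^+ 2)))))).
      rewrite wdl; apply: ler_pM => //; first by rewrite !mulr_ge0 ?expR_ge0.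
      apply: ler_pM => //; rewrite ?(ltW Bs0) ?mulr_ge0 ?expR_ge0//.
      by rewrite ler_wpM2r ?expR_ge0.
    rewrite (mulrAC (expR p)) mulrA mulrA ler_wpM2r//.
    by rewrite -!expRD ler_expR; lra.
  have second : 3 ^+ N * (Bs * (x * (x * eta / dl))) <= expR (- x) / 4.
    apply: (@le_trans _ _ (expR (2 * x) * (expR p / 4 *
      (expR x * (expR x * expR (- ((p + 5) * x))))))).
      rewrite -mulrA etadl.
      apply: ler_pM => //; first by rewrite !mulr_ge0 ?expR_ge0.
      apply: ler_pM => //; rewrite ?(ltW Bs0) ?mulr_ge0 ?expR_ge0//.
      apply: ler_pM => //; rewrite ?mulr_ge0 ?expR_ge0//.
      by rewrite ler_wpM2r ?expR_ge0.
    rewrite (mulrAC (expR p)) mulrA mulrA ler_wpM2r//.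
    by rewrite -!expRD ler_expR; lra.
  rewrite mulrDr mulrDr invfM.
  by move: first second Er; move: (3 ^+ N * _) (3 ^+ N * _) => t1 t2; lra.
- apply: (@le_trans _ _ (expR (2 * x) * (expR p *
      (expR ((p + 6) * x ^+ 2) * expR ((2 * p + 9) * x ^+ 2))))).
    rewrite dlw; apply: ler_pM => //; first by rewrite !mulr_ge0 ?expR_ge0.
    apply: ler_pM => //; rewrite ?(ltW Bs0) ?mulr_ge0 ?expR_ge0//.
      by rewrite (le_trans Bsp)// ler_pdivrMr// ler_peMr ?expR_ge0 ?ler1n.
    by rewrite ler_wpM2r ?expR_ge0.
  by rewrite -!expRD ler_expR; lra.
Qed.

End constants.

(** * Quantitative approximation of H1 functions *)
Section quantitative_approximation.
Context {R : realType}.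
Local Notation mu := (@lebesgue_measure R).
Implicit Types A L dl : R.

(** The ratio of the sup bound at good points to the H1 norm. *)
Definition sup_const L : R := 2 + 2 / L + L / 4.

(** With D = A + L + dl bounding |x - t| for t in I and x in J, the coordinate y
    is at least dl / D and its inverse is Lipschitz with constant D^2 / dl. *)
Definition degree_const A L dl : R :=
  let D := A + L + dl in bernstein_const (D ^+ 2 / dl) (sup_const L) (dl / D).

(** One half of the error M / r comes from the Bernstein polynomial and the other
    from its approximation by a Cauchy transform. *)
Lemma H1_approx (a b c d : R) (h : R -> R) (r : R) (n : nat) :
  a < b -> c < d -> closure `]a, b[ `&` closure `]c, d[ = set0 ->
  H1 `]c, d[ h -> 0 < fine (H1norm `]c, d[ h) -> 1 <= r -> r <= n.+1%:R ->
  let M := fine (H1norm `]c, d[ h) in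
  let dl := set_dist `]a, b[%classic `]c, d[%classic in
  let p := exponent (b - a) dl (sup_const (d - c)) in
  degree_const (b - a) (d - c) dl * r ^+ 4 <= n.+1%:R ->
  exists f : R -> R, [/\ measurable_fun `]a, b[%classic f,
    forall t, `]a, b[%classic t ->
      `|f t| <= M * expR ((4 * p + 17) * n.+1%:R ^+ 2) &
    {ae mu, forall x, `]c, d[%classic x ->
      `|h x - hilbert_on `]a, b[%classic f x| <= M / r}].
Proof.
move=> ab cd disj Hh M0 r1 rn M dl p nbig.
have [dl0 sep far [sg [sg1 sgE]]] := set_dist_separated ab cd disj.
rewrite -/dl in dl0 sep far.
have [D [DJ aeD mod hB]] := H1_good_points cd Hh M0.
rewrite -/M in M0 mod hB.
pose A := b - a; pose L := d - c.
have [A0 L0] : 0 < A /\ 0 < L by rewrite /A /L; lra.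
have D0 : D !=set0.
  by have [z Dz _] := ae_itv_meets aeD (lexx c) cd (lexx d); exists z.
pose Bs := sup_const L.
have Bs0 : 0 < Bs.
  by rewrite /Bs /sup_const addr_gt0 ?addr_gt0 ?divr_gt0.
pose m := (a + b) / 2; pose E := A + L + dl.
have E0 : 0 < E by rewrite /E addr_gt0// addr_gt0.
have Im : `]a, b[%classic m by rewrite /= in_itv /= /m; lra.
have sg0 : sg != 0 by rewrite -normr_gt0 sg1.
(* Dividing by sg makes y positive on J. *)
pose kappa := dl / sg.
have kdl : `|kappa| = dl by rewrite normrM normfV sg1 invr1 mulr1 gtr0_norm.
pose y := inv_coord kappa m.
have xm x : D x -> dl <= `|x - m| <= E.
  by move=> Dx; rewrite sep ?far//; exact: DJ.
have xm0 x : D x -> 0 < `|x - m|.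
  by move=> Dx; have /andP[/(lt_le_trans dl0)] := xm _ Dx.
have yE x : D x -> y x = dl / `|x - m|.
  move=> Dx; rewrite -(sgE _ _ Im (DJ _ Dx)) /y /inv_coord /kappa.
  by rewrite invfM mulrA.
have y01 x : D x -> dl / E <= y x <= 1.
  move=> Dx; have /andP[dlx xE] := xm _ Dx; rewrite yE//.
  rewrite ler_pM2l// lef_pV2 ?posrE ?xm0// xE /=.
  by rewrite ler_pdivrMr ?xm0// mul1r.
have yLip x z : D x -> D z -> `|x - z| <= E ^+ 2 / dl * `|y x - y z|.
  move=> Dx Dz; have [x0 z0] := (xm0 _ Dx, xm0 _ Dz).
  have -> : `|x - z| = `| `|x - m| - `|z - m| |.
    rewrite -(sgE _ _ Im (DJ _ Dx)) -(sgE _ _ Im (DJ _ Dz)) -mulrBr normrM sg1.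
    by rewrite mul1r; congr `|_|; ring.
  have -> : `|x - m| - `|z - m| =
      `|x - m| * `|z - m| / dl * - (y x - y z).
    rewrite !yE//; field; by rewrite !gt_eqF.
  rewrite normrM normrN ler_wpM2r// ger0_norm; last first.
    by rewrite divr_ge0 ?mulr_ge0// ltW.
  rewrite ler_wpM2r ?invr_ge0 ?(ltW dl0)// expr2.
  by have [/andP[_ ?] /andP[_ ?]] := (xm _ Dx, xm _ Dz); rewrite ler_pM.
have La0 : 0 < E ^+ 2 / dl by rewrite divr_gt0// exprn_gt0.
have ym0 : 0 < dl / E by rewrite divr_gt0.
have [v [v0 vB hv]] :=
  bernstein_good_points D0 M0 La0 Bs0 ym0 r1 mod hB yLip y01 nbig.
have [etadl room err bnd] := cauchy_constants A0 dl0 Bs0 r1 rn.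
set eta := dl * _ in etadl room err bnd.
set w := dl * _ in room err bnd.
have [eta0 w0] : 0 < eta /\ 0 < w by rewrite /eta /w !mulr_gt0 ?expR_gt0.
have am : a < m by rewrite /m; lra.
have mb : m + n.+1%:R * eta + w < b by move: room; rewrite /A /m; lra.
have := @approx_bern R a b `]c, d[%classic dl dl0 sep eta w kappa m n.+1
  eta0 w0 kdl am mb etadl n.+1 0 v (Bs * M).
rewrite addn0 leqnn => /(_ isT (fun k _ => vB k) (fun _ => v0)).
move=> [f [mf fB fe]]; exists f; split => //.
  move=> t It; rewrite (le_trans (fB _ It))//.
  apply: le_trans (ler_wpM2l (ltW M0) bnd).
  rewrite le_eqVlt; apply/orP; left; apply/eqP; ring.
case: aeD => N [mN N0 sN]; exists N; split => //.
apply: subset_trans sN => x; apply: contra_not => xD Jx.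
have Dx := xD Jx.
rewrite (hilbert_onE dl0 sep)//.
set C := \int[_]_(_ in _) _.
have h1 := hv _ Dx; have := fe _ Jx; rewrite expr0 mul1r -/C -/y => h2.
have h3 : 3 ^+ n.+1 * (Bs * M * ((2 * dl / eta) ^+ n.+1 * (w / dl) +
    n.+1%:R * (n.+1%:R * eta / dl))) <= M / (2 * r).
  apply: le_trans (ler_wpM2l (ltW M0) err).
  rewrite le_eqVlt; apply/orP; left; apply/eqP; ring.
have -> : M / r = M / (2 * r) + M / (2 * r).
  field; rewrite gt_eqF// (lt_le_trans _ r1)//.
have := ler_normD (h x - bern n.+1 v (y x)) (bern n.+1 v (y x) - C).
rewrite subrKA => /le_trans; apply; apply: lerD => //.
exact: le_trans h2 h3.
Qed.

End quantitative_approximation.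

(** The degree is at most 2 K rho^4, the control at most exp (O(n^2)) times M, and
    1 + A and rho are absorbed as exponentials too; the final 2 makes the constant
    exceed 1. *)
Definition cost_const (R : realType) (A L dl : R) : R :=
  let K := (degree_const A L dl + 1) * (1 + L) ^+ 4 in
  (4 * exponent A dl (sup_const L) + 18 + A) * (4 * K ^+ 2) + 2.

Section cost.
Context {R : realType}.

(** The factor (1 + L) of rho turns a uniform error into an L2 error on J, as
    sqrt L <= 1 + L; likewise 1 + A bounds the passage to the L2 norm on I. *)
Lemma cost_le (A L dl rho : R) : 0 < A -> 0 < L -> 0 < dl -> 1 <= rho ->
  1 < cost_const A L dl /\
  exists n : nat, [/\ (1 + L) * rho <= n.+1%:R,
    degree_const A L dl * ((1 + L) * rho) ^+ 4 <= n.+1%:R &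
    (1 + A) * (rho *
      expR ((4 * exponent A dl (sup_const L) + 17) * n.+1%:R ^+ 2)) <=
    expR (cost_const A L dl * (1 + rho ^+ 8))].
Proof.
move=> A0 L0 dl0 rho1; rewrite /cost_const.
set p := exponent _ _ _; set G := degree_const _ _ _.
set K := (G + 1) * _; set P := 4 * p + 18 + A.
have rho0 : 0 <= rho by rewrite (le_trans _ rho1).
have Bs0 : 0 <= sup_const L.
  by rewrite /sup_const !addr_ge0 ?divr_ge0// ltW.
have p0 : 0 <= p.
  by rewrite addr_ge0 ?divr_ge0 ?mulr_ge0// ltW.
have D0 : 0 < A + L + dl by rewrite addr_gt0// addr_gt0.
have G0 : 0 <= G.
  rewrite /G /degree_const /bernstein_const.
  have La0 : 0 <= (A + L + dl) ^+ 2 / dl by rewrite divr_ge0 ?sqr_ge0// ltW.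
  move: (_ / dl) La0 => La La0.
  rewrite addr_ge0 ?divr_ge0 ?sqr_ge0//; last by rewrite mulr_ge0.
  by rewrite addr_ge0// mulr_ge0// sqr_ge0.
have L1 : 1 <= 1 + L by rewrite lerDl ltW.
have L4 : 1 + L <= (1 + L) ^+ 4 by rewrite -[leLHS]expr1 ler_weXn2l.
have r4 : rho <= rho ^+ 4 by rewrite -[leLHS]expr1 ler_weXn2l.
have L40 : 0 <= (1 + L) ^+ 4 by rewrite exprn_ge0// addr_ge0// ltW.
have r40 : 0 <= rho ^+ 4 by rewrite exprn_ge0.
have KL : (1 + L) ^+ 4 <= K by rewrite ler_peMl// lerDr.
have K1 : 1 <= K by rewrite (le_trans L1)// (le_trans L4).
have P0 : 0 <= P by rewrite /P !addr_ge0 ?mulr_ge0// ltW.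
have PK0 : 0 <= P * (4 * K ^+ 2) by rewrite mulr_ge0// mulr_ge0 ?sqr_ge0.
split; first by lra.
have Kr1 : 1 <= K * rho ^+ 4 by rewrite mulr_ege1// exprn_ege1.
have Kr0 : 0 <= K * rho ^+ 4 by rewrite (le_trans _ Kr1).
pose n := Num.truncn (K * rho ^+ 4).
have /andP[nle ltn] := truncn_itv Kr0.
rewrite -/n in nle ltn.
set x : R := n.+1%:R in ltn.
have xK : x <= 2 * (K * rho ^+ 4) by rewrite /x -natr1; lra.
have rx : (1 + L) * rho <= x.
  apply: le_trans (ltW ltn); apply: ler_pM => //.
    by rewrite (le_trans _ L1).
  exact: le_trans L4 KL.
have rhox : rho <= x by rewrite (le_trans _ rx)// ler_peMl.
have x1 : 1 <= x by rewrite (le_trans rho1).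
have x0 : 0 <= x by rewrite (le_trans _ x1).
have xx : x <= x ^+ 2 by rewrite expr2 ler_peMl.
exists n; rewrite -/x; split => //.
  rewrite (le_trans _ (ltW ltn))// exprMn mulrA ler_wpM2r//.
  by rewrite ler_wpM2r// lerDl.
apply: (@le_trans _ _ (expR (P * x ^+ 2))).
  have e1 : 1 + A <= expR (A * x ^+ 2).
    rewrite (le_trans (expR_ge1Dx A))// ler_expR ler_peMr ?(ltW A0)//.
    exact: le_trans x1 xx.
  have e2 : rho <= expR (x ^+ 2).
    rewrite (le_trans rhox)// (le_trans xx)//.
    by have := expR_ge1Dx (x ^+ 2); lra.
  have -> : P * x ^+ 2 = A * x ^+ 2 + (x ^+ 2 + (4 * p + 17) * x ^+ 2).
    by rewrite /P; ring.
  rewrite !expRD; apply: ler_pM => //; first by rewrite addr_ge0// ltW.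
    by rewrite mulr_ge0// expR_ge0.
  by rewrite ler_wpM2r ?expR_ge0.
rewrite ler_expR.
have x2 : x ^+ 2 <= 4 * K ^+ 2 * rho ^+ 8.
  apply: (@le_trans _ _ ((2 * (K * rho ^+ 4)) ^+ 2)).
    by rewrite lerXn2r// nnegrE mulr_ge0.
  by rewrite le_eqVlt; apply/orP; left; apply/eqP; ring.
have r80 : 0 <= rho ^+ 8 by rewrite exprn_ge0.
apply: (le_trans (ler_wpM2l P0 x2)); rewrite mulrA.
rewrite mulrDr mulr1 (mulrDl _ 2).
by move: (P * (4 * K ^+ 2) * rho ^+ 8) PK0 => t; lra.
Qed.

End cost.

Theorem proposition1p2 (R : realType) :
  exists sigma C : R -> R -> R -> R,
  forall a b c d : R, a < b -> c < d ->
  let I : set R := [set` `]a, b[] in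
  let J : set R := [set` `]c, d[] in
  closure I `&` closure J = set0 ->
  let s := sigma (b - a) (d - c) (set_dist I J) in
  let K := C (b - a) (d - c) (set_dist I J) in
  [/\ 0 < s, 1 < K &
    forall (eps : R) (h : R -> R), 0 < eps -> H1 J h ->
    exists f : R -> R,
      [/\ L2 I f,
          (L2norm J (h \- hilbert_on I f)%R <= eps%:E)%E &
          (L2norm I f <=
             (expR (K * (1 + fine (H1norm J h) `^ s / eps `^ s)))%R%:E
             * L2norm J h)%E]].
Proof.
exists (fun _ _ _ => 8), (@cost_const R) => a b c d ab cd I J disj s K.
have [dl0 sep _ _] := set_dist_separated ab cd disj.
pose A := b - a; pose L := d - c; pose dl := set_dist I J.
have [A0 L0] : 0 < A /\ 0 < L by rewrite /A /L; lra.
have [K1 _] := cost_le A0 L0 dl0 (lexx 1).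
split => //.
move=> eps h eps0 Hh.
have mI : measurable I by exact: measurable_itv.
have mJ : measurable J by exact: measurable_itv.
have muI : lebesgue_measure I = A%:E.
  by rewrite /I lebesgue_measure_itv /= lte_fin ab -EFinB.
have muJ : lebesgue_measure J = L%:E.
  by rewrite /J lebesgue_measure_itv /= lte_fin cd -EFinB.
have fI : (lebesgue_measure I < +oo)%E by rewrite muI ltry.
have [lh _] := Hh.
pose M := fine (H1norm J h); pose h2 := Num.sqrt (sqint J h).
have hE : L2norm J h = h2%:E by exact: L2norm_sqint.
have h20 : 0 <= h2 by exact: sqrtr_ge0.
have hM : h2 <= M.
  by rewrite /M /J H1normE//= ler_wsqrtr// lerDl sqint_ge0.
have [heps|epsh] := leP h2 eps.
  exists (fun=> 0); split.
  - by apply: (@L2_bounded _ _ _ 0) => // x _; rewrite normr0.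
  - rewrite (_ : L2norm J _ = L2norm J h) ?hE ?lee_fin//.
    rewrite -hE /L2norm; apply: eq_Lnorm => x /=; congr EFin.
    rewrite /patch; case: ifPn => // /set_mem Jx.
    rewrite /= (hilbert_onE dl0 sep)//.
    under eq_Rintegral do rewrite mul0r.
    by rewrite Rintegral_cst// mul0r subr0.
  - apply: (@le_trans _ _ 0%E); last by rewrite mule_ge0 ?lee_fin ?expR_ge0 ?hE.
    apply: (@L2norm_bounded _ _ _ 0 0 A) => //.
      by apply: aeW => x _; rewrite normr0.
    by rewrite expr0n mul0r.
have M0 : 0 < M by rewrite (lt_le_trans _ hM)// (lt_trans eps0).
pose rho := M / eps.
have rho1 : 1 <= rho.
  by rewrite ler_pdivlMr// mul1r (le_trans (ltW epsh)).
have [_ [n [rn degn costn]]] := cost_le A0 L0 dl0 rho1.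
have r1 : 1 <= (1 + L) * rho by rewrite mulr_ege1// lerDl ltW.
have [f [mf fB fh]] := H1_approx ab cd disj Hh M0 r1 rn degn.
exists f; split.
- exact: (L2_bounded mI fI mf fB).
- apply: (@L2norm_bounded _ _ _ _ _ L mJ muJ _ fh).
  + apply: measurable_funB; first exact: L2_measurable.
    exact: measurable_hilbert_on dl0 sep _ _ mf fB.
  + by rewrite divr_ge0 ?(ltW M0)// (le_trans _ r1).
  + exact: ltW.
  + have -> : fine (H1norm `]c, d[ h) / ((1 + L) * rho) = eps / (1 + L).
      rewrite -/J -/M /rho; field; rewrite !gt_eqF//; last by rewrite addr_gt0.
    have L1 : L <= (1 + L) ^+ 2 by nra.
    have L2 : 0 < (1 + L) ^+ 2 by rewrite exprn_gt0// addr_gt0.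
    have -> : (eps / (1 + L)) ^+ 2 * L = eps ^+ 2 * (L / (1 + L) ^+ 2).
      by field; rewrite gt_eqF// addr_gt0.
    by rewrite ler_piMr ?sqr_ge0// ler_pdivrMr// mul1r.
- rewrite hE -EFinM.
  have -> : fine (H1norm J h) `^ s / eps `^ s = rho ^+ 8.
    by rewrite !powR_mulrn ?(ltW M0) ?(ltW eps0)// /rho expr_div_n.
  have fB' : {ae lebesgue_measure, forall t, I t -> `|f t| <= M *
      expR ((4 * exponent A dl (sup_const L) + 17) * n.+1%:R ^+ 2)}.
    by apply: aeW => t It; exact: fB.
  have cost : (1 + A) * (M * expR ((4 * exponent A dl (sup_const L) + 17) *
      n.+1%:R ^+ 2)) <= expR (K * (1 + rho ^+ 8)) * h2.
    apply: (@le_trans _ _ (expR (K * (1 + rho ^+ 8)) * eps)); last first.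
      by rewrite ler_wpM2l ?expR_ge0// ltW.
    apply: le_trans (ler_wpM2r (ltW eps0) costn).
    rewrite le_eqVlt; apply/orP; left; apply/eqP.
    by rewrite /rho; field; rewrite gt_eqF.
  apply: (@L2norm_bounded _ _ _ _ _ A mI muI mf fB').
  + by rewrite mulr_ge0 ?expR_ge0// ltW.
  + by rewrite mulr_ge0 ?expR_ge0.
  move: cost; set c' := M * expR _; set e' := expR _ * h2 => cost.
  have c0 : 0 <= c' by rewrite mulr_ge0 ?expR_ge0// ltW.
  have A1 : A <= (1 + A) ^+ 2 by nra.
  apply: (@le_trans _ _ (((1 + A) * c') ^+ 2)).
    have -> : ((1 + A) * c') ^+ 2 = (1 + A) ^+ 2 * c' ^+ 2 by ring.
    by rewrite [leLHS]mulrC ler_wpM2r ?sqr_ge0.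
  have A10 : 0 <= 1 + A by rewrite addr_ge0// ltW.
  by rewrite lerXn2r// nnegrE mulr_ge0// expR_ge0.
Qed.
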